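(* For every $0<\alpha<1$ there exist constants $C(\alpha)>0$ and $c(\alpha)>0$, depending only on $\alpha$, such that the following holds. Let $\Omega\subset\mathbb{R}^2=\mathbb{C}$ be a bounded simply connected domain. Then for every $z\in\Omega$ there is a subdomain $\Omega_z\subset\Omega$ which is $C(\alpha)$-John with center $z$ and satisfies $$\mathcal{H}^{\alpha}_{\infty}(\partial\Omega_z\cap\partial\Omega)\;\geq\; c(\alpha)\, d_{\Omega}(z)^{\alpha}.$$
   Context: For a domain $G\subset\mathbb{C}$ and $w\in G$, $d_G(w):=\mathrm{dist}(w,\partial G)$ is the Euclidean distance to the boundary. A domain $G\subset\mathbb{C}$ is called $C$-John with center $z_0\in G$ if for every $z\in G$ there exists a rectifiable curve $\gamma_z$ joining $z$ and $z_0$ in $G$ such that for every point $z'$ in the image of $\gamma_z$ one has $C\,d_G(z')\geq l(\gamma_z(z',z))$, where $l(\gamma_z(z',z))$ is the length of the subcurve of $\gamma_z$ between $z'$ and $z$. The number $C$ is called the John constant. For $A\subset\mathbb{C}$ the $\alpha$-Hausdorff content is $\mathcal{H}^{\alpha}_{\infty}(A):=\inf\{\sum_{j=1}^{\infty}\mathrm{diam}(E_j)^{\alpha}: E_j\subset\mathbb{C},\ A\subset\bigcup_{j\in\mathbb{N}}E_j\}$. *)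

(* Defs.v *)
From HB Require Import structures.
From mathcomp Require Import all_boot all_order all_algebra.
From mathcomp Require Import complex.
From mathcomp Require Import all_classical all_reals all_analysis.

Set Implicit Arguments.
Unset Strict Implicit.
Unset Printing Implicit Defensive.

Import Order.TTheory GRing.Theory Num.Theory.
Import numFieldNormedType.Exports.

Local Open Scope classical_set_scope.
Local Open Scope ring_scope.

(* The complex plane is [Rcomplex R]: the real vector space R[i] whose norm
   [`|x + i y| = Num.sqrt (x ^+ 2 + y ^+ 2)] takes its values in R.
   It receives here the topology and the metric of this norm. *)
Section Rcomplex_normedModType.
Variable R : realType.

Lemma Rcomplex_normrZ (a : R) (z : Rcomplex R) : `|a *: z| = `|a| * `|z|.
Proof.
case: z => x y; rewrite /Num.norm /= /Normc.normc /=.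
by rewrite !exprMn -mulrDr sqrtrM ?sqr_ge0// sqrtr_sqr.
Qed.

HB.instance Definition _ :=
  PseudoMetric.copy (Rcomplex R) (pseudoMetric_normed (Rcomplex R)).
HB.instance Definition _ := isPointed.Build (Rcomplex R) 0.
HB.instance Definition _ :=
  NormedZmod_PseudoMetric_eq.Build R (Rcomplex R) erefl.
HB.instance Definition _ :=
  PseudoMetricNormedZmod_Lmodule_isNormedModule.Build R (Rcomplex R)
    Rcomplex_normrZ.

End Rcomplex_normedModType.

Section topological_notions.
Context {R : realType} {T : topologicalType}.
Implicit Types (A U : set T) (g : R -> T).

Definition boundary A : set T := closure A `\` interior A.

Definition domain U := [/\ open U, connected U & U !=set0].

Definition curve_in U x y g :=
  [/\ {within `[0, 1], continuous g}, g 0 = x, g 1 = y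
    & forall t : R, t \in `[0, 1] -> U (g t)].

Definition null_homotopic_in U x g := exists H : R * R -> T,
  [/\ {within `[0, 1] `*` `[0, 1], continuous H},
      forall s t : R, s \in `[0, 1] -> t \in `[0, 1] -> U (H (s, t)),
      forall t : R, t \in `[0, 1] -> H (0, t) = g t,
      forall t : R, t \in `[0, 1] -> H (1, t) = x
    & forall s : R, s \in `[0, 1] -> H (s, 0) = x /\ H (s, 1) = x].

Definition simply_connected U :=
  (forall x y, U x -> U y -> exists g, curve_in U x y g) /\
  (forall x g, curve_in U x x g -> null_homotopic_in U x g).

End topological_notions.
Arguments simply_connected R {T} U.

Section metric_notions.
Context {R : realType} {V : normedModType R}.
Implicit Types (A G : set V) (g : R -> V).

(* Length of [g] restricted to the interval [a, b]. A partition [s] of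
   [a, b] lists the points a < s_0 < s_1 < ... < s_n = b without [a]. *)
Definition curve_length (a b : R) g : \bar R := ereal_sup
  [set (\sum_(0 <= k < size s)
          `|g (nth b (a :: s) k.+1) - g (nth b (a :: s) k)|)%:E
   | s in itv_partition a b].

Definition rectifiable g := (curve_length 0 1 g < +oo)%E.

(* On a normed space [edist (x, y)] is [`|x - y|%:E]; the distance to an empty
   boundary is +oo. *)
Definition dist_boundary G (w : V) : \bar R := edist_inf (boundary G) w.

(* The curve runs from [z] at time 0 to the center [z0] at time 1, so that its
   subcurve between [z] and [g t] is the restriction of [g] to [0, t]. *)
Definition john_domain (C : R) (z0 : V) G :=
  [/\ domain G, G z0 &
      forall z, G z -> exists g : R -> V,
        [/\ curve_in G z z0 g, rectifiable g &
            forall t : R, t \in `[0, 1] ->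
              (curve_length 0 t g <= C%:E * dist_boundary G (g t))%E]].

(* The maximum with 0 gives the empty set the diameter 0. *)
Definition diam A : \bar R :=
  maxe 0%E (ereal_sup [set `|p.1 - p.2|%:E | p in A `*` A]).

Definition hausdorff_content (alpha : R) A : \bar R := ereal_inf
  [set (\sum_(0 <= j <oo) diam (E j) `^ alpha)%E
   | E in [set E : nat -> set V | A `<=` \bigcup_j E j]].

End metric_notions.

(* Main.v *)
Require Import Defs.
From mathcomp Require Import all_boot all_order all_algebra.
From mathcomp Require Import complex.
From mathcomp Require Import all_classical all_reals all_analysis.
From mathcomp Require Import ring lra zify.

(** The domain is obtained from a self-similar tree, without conformal maps.

    Let [w] be a point of [Omega] at distance [r] from the complement and let [N]
    be a large integer. There are [N] points of [Omega], all at distance [e * r]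
    from the complement with [e] a constant multiple of [1 / N], at mutual
    distances at least a large constant times [e * r], and each joined to [w] by
    an arc of length at most [40 * r] that keeps the distance [e * r] from the
    complement (lemma [branching]). Simple connectedness enters there, through
    the fact that the boundary of a square that surrounds a point outside
    [Omega] is not contained in [Omega] (lemma [square_escapes]), which is proved
    with a discrete winding number: loops are sampled, the quadrants of the
    samples are compared, and the count is invariant under homotopy because it is
    zero around each cell of a fine grid (lemmas [turn_grid] and
    [winding_homotopy]).

    Applying this to [z], then to the [N] points so obtained, and so on, gives
    [N ^ m] points of generation [m] at distance [e ^ m * d] from the complement,
    where [d] is the distance of [z]. The subdomain is the union of discs about
    all points that can be reached from a node within the length and the
    clearance of its generation, with half of that clearance as radius. It is a
    John domain because the arcs followed back to [z] grow geometrically, like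
    the clearance (lemmas [linked_john] and [tree_domain_john]).

    The infinite branches of the tree converge to points in both boundaries.
    They are indexed by the digits in base [N] of the numbers of [[0, 1[], and
    branches that differ in one of the first [m] digits have ends at distance at
    least a constant times [e ^ m * d]. Hence a set of diameter less than that
    only contains ends whose parameters lie in one interval of length
    [N ^ - m], and [N ^ - m <= (e ^ m) ^ alpha] if [N ^ - 1 <= e ^ alpha].
    The latter holds for large [N] exactly because [e] is comparable to [1 / N]
    and [alpha < 1]. Countable subadditivity of the Lebesgue measure then bounds
    the content from below (lemma [content_ge]). *)

Import Order.TTheory GRing.Theory Num.Theory.
Import numFieldNormedType.Exports.

Local Open Scope classical_set_scope.
Local Open Scope ring_scope.
Set Implicit Arguments.
Unset Strict Implicit.
Unset Printing Implicit Defensive.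

(** * Distance to the complement *)

Section metric_preliminaries.
Context {R : realType} {V : normedModType R}.
Implicit Types (A : set V) (p q x : V) (g : R -> V).

(** At points of an open set this is the distance to the boundary, but it is
    real-valued and 1-Lipschitz on the whole space and vanishes on the
    complement. *)
Definition codist A p : R := inf [set `|p - x| | x in ~` A].

Lemma codist_le A p x : ~ A x -> codist A p <= `|p - x|.
Proof.
move=> Ax; apply: ge_inf; last by exists x.
by exists 0 => _ [y _ <-].
Qed.

Lemma codist_ge0 A p : 0 <= codist A p.
Proof.
have [A0|/set0P[x Ax]] := eqVneq (~` A) set0.
  by rewrite /codist A0 image_set0 inf0.
by apply: lb_le_inf; [exists `|p - x|, x | move=> _ [y _ <-]].
Qed.

Lemma codist_out A p : ~ A p -> codist A p = 0.
Proof.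
move=> Ap; apply/eqP; rewrite eq_le codist_ge0 andbT.
by rewrite (le_trans (codist_le p Ap))// subrr normr0.
Qed.

Lemma codist_in A p q : `|p - q| < codist A p -> A q.
Proof.
move=> pq; apply: contrapT => Aq.
by move: pq; rewrite ltNge codist_le.
Qed.

Lemma codist_near A p e : ~` A !=set0 -> codist A p < e ->
  exists2 x, ~ A x & `|p - x| < e.
Proof.
move=> [y Ay] pe.
have hinf : has_inf [set `|p - x| | x in ~` A].
  by split; [exists `|p - y|, y | exists 0 => _ [x _ <-]].
have := inf_adherent (eps := e - codist A p) _ hinf.
rewrite subr_gt0 => /(_ pe)[_ [x Ax <-]].
by rewrite -/(codist A p) [ltRHS]addrC subrK => xe; exists x.
Qed.

Lemma codist_lip A p q : ~` A !=set0 -> codist A p <= codist A q + `|p - q|.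
Proof.
move=> A0; apply/ler_addgt0Pr => e e0.
have [|x Ax xe] := @codist_near A q (codist A q + e) A0; first by rewrite ltrDl.
rewrite (le_trans (codist_le p Ax))//.
rewrite (le_trans (ler_distD q p x))// addrC addrAC lerD2r; exact: ltW.
Qed.

Lemma codist_gt0 A p : ~` A !=set0 -> open A -> A p -> 0 < codist A p.
Proof.
move=> A0 oA Ap; have /nbhs_ballP[e /= e0 eA] := open_nbhs_nbhs (conj oA Ap).
rewrite ltNge; apply/negP => cle.
have [x Ax] := codist_near A0 (le_lt_trans cle e0).
by move=> xe; apply: Ax; apply: eA; rewrite -ball_normE.
Qed.

Lemma edistE p q : edist (p, q) = `|p - q|%:E.
Proof.
apply/eqP; rewrite eq_le; apply/andP; split.
  apply/lee_addgt0Pr => e e0; apply: ereal_inf_lbound.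
  exists (`|p - q| + e) => //=; split; first by rewrite ltr_wpDl.
  by rewrite -ball_normE /= ltrDl.
apply/ereal_infP => _ [r [r0 + <-]].
by rewrite -ball_normE /= lee_fin => /ltW.
Qed.

(** The segment from an interior point to a point of the complement meets the
    boundary at the last time before which it stays in the open set. *)
Lemma dist_boundary_le_codist A p : ~` A !=set0 -> open A -> A p ->
  (dist_boundary A p <= (codist A p)%:E)%E.
Proof.
move=> A0 oA Ap; apply/lee_addgt0Pr => e e0.
have [|x Ax xe] := @codist_near A p (codist A p + e) A0; first by rewrite ltrDl.
pose g (t : R) := p + t *: (x - p).
have gg s t : `|g s - g t| = `|s - t| * `|x - p|.
  by rewrite /g opprD addrACA subrr add0r -scalerBl normrZ.
have xp0 : 0 < `|x - p|.
  by rewrite normr_gt0 subr_eq0; apply/eqP => xp; apply: Ax; rewrite xp.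
pose T := [set t : R | 0 <= t <= 1 /\ forall s : R, 0 <= s <= t -> A (g s)].
have T0 : T 0.
  split; first by rewrite lexx ler01.
  by move=> s; rewrite -eq_le => /eqP <-; rewrite /g scale0r addr0.
have hs : has_sup T.
  by split; [exists 0 | exists 1 => t [/andP[]]].
set tau := sup T.
have tau0 : 0 <= tau by apply: sup_upper_bound.
have tau1 : tau <= 1 by apply: ge_sup; [exists 0 | move=> t [/andP[]]].
have Tlt (s : R) : 0 <= s < tau -> A (g s).
  move=> /andP[s0 st]; have : 0 < tau - s by rewrite subr_gt0.
  move=> /sup_adherent/(_ hs)[t [_ Tt]].
  by rewrite -/tau opprB addrC subrK => ts; apply: Tt; rewrite s0 ltW.
(* Otherwise the segment would stay in the set a little after [tau]. *)
have nAtau : ~ A (g tau).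
  move=> Atau.
  have /nbhs_ballP[d /= d0 dA] := open_nbhs_nbhs (conj oA Atau).
  pose d' := d / 2 / `|x - p|.
  have d'0 : 0 < d' by rewrite !divr_gt0.
  have As (s : R) : 0 <= s <= tau + d' -> A (g s).
    move=> /andP[s0 sd]; have [st|ts] := ltP s tau.
      by apply: Tlt; rewrite s0.
    apply: dA; rewrite -ball_normE /= gg -ltr_pdivlMr// distrC.
    rewrite ger0_norm ?subr_ge0//.
    rewrite (le_lt_trans (y := d'))//; first by rewrite lerBlDl.
    by rewrite ltr_pM2r ?invr_gt0// ltr_pdivrMr// ltr_pMr// ltrDr.
  have [t1|t1] := leP 1 (tau + d').
    by apply: Ax; have := As 1; rewrite ler01 t1 /g scale1r addrC subrK; apply.
  suff : T (tau + d').
    by move/(sup_upper_bound hs); rewrite -/tau gerDl leNgt d'0.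
  by split=> //; rewrite addr_ge0 ?(ltW d'0)//= ltW.
have btau : boundary A (g tau).
  split; last by move/interior_subset.
  move=> B /nbhs_ballP[d /= d0 dB].
  (* The points just before [tau] are in the set and close to [g tau]. *)
  have tau_gt0 : 0 < tau.
    rewrite lt_neqAle tau0 andbT; apply/eqP => t0; apply: nAtau.
    by rewrite -t0 /g scale0r addr0.
  have dx : 0 < d / `|x - p| by rewrite divr_gt0.
  have [s [s0 st sd]] : exists s, [/\ 0 <= s, s < tau & tau - s < d / `|x - p|].
    have [dt|dt] := leP (d / `|x - p|) tau.
      exists (tau - d / `|x - p| / 2); split; lra.
    by exists (tau / 2); split; lra.
  exists (g s); split; first by apply: Tlt; rewrite s0.
  apply: dB; rewrite -ball_normE /= gg ger0_norm ?subr_ge0 1?ltW//.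
  by rewrite -ltr_pdivlMr.
apply: (@le_trans _ _ `|p - g tau|%:E).
  by apply: ereal_inf_lbound; exists (g tau) => //; rewrite edistE.
rewrite -EFinD lee_fin; apply: (le_trans _ (ltW xe)).
rewrite -[p in leLHS]addr0 -(scale0r (x - p)) -/(g 0) gg sub0r normrN.
by rewrite ger0_norm// distrC ler_piMl.
Qed.

(** The boundary of an open set is disjoint from it. *)
Lemma dist_boundary_ge A p (e : R) : open A ->
  (forall q, `|p - q| < e -> A q) -> (e%:E <= dist_boundary A p)%E.
Proof.
move=> oA eA; apply/ereal_infP => _ [q [_ Aq] <-].
rewrite edistE lee_fin leNgt; apply/negP => /eA Aq'.
by apply: Aq; rewrite (interior_id A).1.
Qed.

(** The witness is the supremum of the times up to which the quantity stays above
    the level. *)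
Lemma first_level (f : R -> R) (l e : R) : 0 <= l ->
  (forall s t, f s <= f t + `|s - t|) -> e <= f 0 -> f l <= e ->
  exists t, [/\ 0 <= t <= l, f t = e & forall s : R, 0 <= s <= t -> e <= f s].
Proof.
move=> l0 flip f0 fl.
pose T := [set t : R | 0 <= t <= l /\ forall s : R, 0 <= s <= t -> e <= f s].
have T0 : T 0.
  by split; [rewrite lexx l0 | move=> s; rewrite -eq_le => /eqP <-].
have hs : has_sup T.
  by split; [exists 0 | exists l => t [/andP[]]].
set tau := sup T.
have tau0 : 0 <= tau by apply: sup_upper_bound.
have taul : tau <= l by apply: ge_sup; [exists 0 | move=> t [/andP[]]].
have Tlt (s : R) : 0 <= s < tau -> e <= f s.
  move=> /andP[s0 st]; have : 0 < tau - s by rewrite subr_gt0.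
  move=> /sup_adherent/(_ hs)[t [_ Tt]].
  by rewrite -/tau opprB addrC subrK => ts; apply: Tt; rewrite s0 ltW.
have ftau : e <= f tau.
  rewrite leNgt; apply/negP => ftau.
  have [t0|t0] := eqVneq tau 0; first by move: ftau; rewrite t0 ltNge f0.
  have {}t0 : 0 < tau by rewrite lt_neqAle eq_sym t0.
  have [s [s0 st sd]] : exists s, [/\ 0 <= s, s < tau & tau - s < e - f tau].
    have [dt|dt] := leP (e - f tau) tau.
      by exists (tau - (e - f tau) / 2); split; lra.
    by exists (tau / 2); split; lra.
  have := Tlt s; rewrite s0 st => /(_ isT); apply/negP; rewrite -ltNge.
  rewrite (le_lt_trans (flip s tau))// distrC ger0_norm ?subr_ge0 1?ltW//; lra.
have Tle (s : R) : 0 <= s <= tau -> e <= f s.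
  by move=> /andP[s0]; rewrite le_eqVlt => /orP[/eqP->//|st]; apply: Tlt; rewrite s0.
exists tau; split; rewrite ?tau0//; apply/eqP; rewrite eq_le ftau andbT leNgt.
apply/negP => fe.
have := flip tau l; rewrite distrC ger0_norm ?subr_ge0// => ftl.
suff : T (f tau - e + tau) by move/(sup_upper_bound hs); rewrite -/tau; lra.
split; first by apply/andP; split; lra.
move=> s /andP[s0 st]; have [ts|ts] := leP s tau; first by apply: Tle; rewrite s0.
have := flip tau s; rewrite distrC ger0_norm ?subr_ge0 ?(ltW ts)//; lra.
Qed.

(** The supremum of the lower bounds [u m - err m] lies below all the upper bounds
    [u n + err n], since any two of these intervals meet. *)
Lemma limit_with_errors (u err : nat -> R) :
  (forall m n, `|u (m + n)%N - u m| <= err m) ->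
  exists x : R, forall m, `|x - u m| <= err m.
Proof.
move=> uE; have err0 m : 0 <= err m by exact: le_trans (uE m 0%N).
have cross m n : u m - err m <= u n + err n.
  have := err0 m; have := err0 n; have [mn|/ltnW nm] := leqP m n.
    by have := uE m (n - m)%N; rewrite subnKC// ler_norml => /andP[? ?]; lra.
  by have := uE n (m - n)%N; rewrite subnKC// ler_norml => /andP[? ?]; lra.
pose E := range (fun m => u m - err m).
have E0 : E !=set0 by exists (u 0 - err 0), 0%N.
have hs : has_sup E by split=> //; exists (u 0 + err 0) => _ [m _ <-].
exists (sup E) => m; rewrite ler_distl; apply/andP; split.
  by apply: sup_upper_bound => //; exists m.
by apply: ge_sup => // _ [n _ <-].
Qed.

End metric_preliminaries.

(** * Curves as 1-Lipschitz maps *)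

Section arcs.
Context {R : realType} {V : normedModType R}.
Implicit Types (A B : set V) (p q : V) (g : R -> V).

(** The John inequality bounds the length of a curve from above, so it is enough
    to work with 1-Lipschitz maps, whose time bounds their length. They are taken
    on the whole line, so that translating and gluing them needs no side
    condition on the endpoints of an interval. *)
Definition lip1 g := forall s t : R, `|g s - g t| <= `|s - t|.

Definition arc_in A (l : R) p q g :=
  [/\ 0 <= l, lip1 g, g 0 = p, g l = q
    & forall t : R, 0 <= t <= l -> A (g t)].

Lemma arc_in_dist A l p q g : arc_in A l p q g -> `|p - q| <= l.
Proof.
by move=> [l0 gl <- <- _]; rewrite (le_trans (gl _ _))// sub0r normrN ger0_norm.
Qed.

Lemma arc_in_rev A l p q g :
  arc_in A l p q g -> arc_in A l q p (fun t => g (l - t)).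
Proof.
move=> [l0 gl g0 gl' gA]; split=> //; rewrite ?subr0 ?subrr//.
  move=> s t; rewrite (le_trans (gl _ _))//.
  by rewrite opprD opprK addrACA subrr add0r -normrN opprD opprK.
by move=> t /andP[t0 tl]; apply: gA; rewrite subr_ge0 tl gerBl.
Qed.

Lemma arc_in_cat A l1 l2 p q x g1 g2 :
  arc_in A l1 p q g1 -> arc_in A l2 q x g2 ->
  arc_in A (l1 + l2) p x (fun t => if t <= l1 then g1 t else g2 (t - l1)).
Proof.
move=> [l10 g1l g10 g1e g1A] [l20 g2l g20 g2e g2A].
split; rewrite ?addr_ge0//.
- have H (s t : R) : s <= l1 -> l1 < t -> `|g1 s - g2 (t - l1)| <= t - s.
    move=> sl lt; rewrite (le_trans (ler_distD q _ _))//.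
    rewrite -{1}g1e -{1}g20.
    rewrite (le_trans (lerD (g1l _ _) (g2l _ _)))//.
    rewrite sub0r normrN [X in _ + X]ger0_norm ?subr_ge0 ?(ltW lt)//.
    by rewrite distrC ger0_norm ?subr_ge0//; lra.
  move=> s t /=; case: (leP s l1) => sl; case: (leP t l1) => tl //.
  + by rewrite (le_trans (H _ _ sl tl))// distrC ler_norm.
  + by rewrite distrC (le_trans (H _ _ tl sl))// ler_norm.
  + by rewrite (le_trans (g2l _ _))// opprB addrA subrK.
- by rewrite l10.
- case: leP => [|_]; last by rewrite addrAC subrr add0r.
  rewrite gerDl => l2_le0; have l2E : l2 = 0 by apply/eqP; rewrite eq_le l2_le0.
  by rewrite l2E addr0 g1e -g2e l2E g20.
- move=> t /andP[t0 tl]; case: leP => tl1; first by apply: g1A; rewrite t0.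
  by apply: g2A; rewrite subr_ge0 ltW//= lerBlDl.
Qed.

(** The division by the norm only makes sense for distinct endpoints; at equal
    endpoints the convention [0^-1 = 0] gives the constant curve. *)
Definition segment_arc p q (t : R) : V := p + (t / `|q - p|) *: (q - p).

Lemma segment_arcP p q : arc_in setT `|q - p| p q (segment_arc p q).
Proof.
split=> //; rewrite /segment_arc.
- move=> s t; rewrite opprD addrACA subrr add0r -scalerBl -mulrBl normrZ normrM.
  have [->|qp] := eqVneq (q - p) 0; first by rewrite normr0 mulr0.
  by rewrite [`|_^-1|]ger0_norm ?invr_ge0// mulfVK ?normr_eq0.
- by rewrite mul0r scale0r addr0.
- have [qp|qp] := eqVneq (q - p) 0.
    by rewrite qp scaler0 addr0; apply/esym/eqP; rewrite -subr_eq0 qp.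
  by rewrite divff ?normr_eq0// scale1r addrC subrK.
Qed.

(** The curve is cut at the first time at which its distance to the complement
    drops to [e]. *)
Lemma arc_first_exit A l e p q g : ~` A !=set0 -> arc_in setT l p q g ->
  e <= codist A p -> codist A q <= e ->
  exists t : R, [/\ 0 <= t <= l, codist A (g t) = e &
    arc_in [set x | e <= codist A x] t p (g t) g].
Proof.
move=> A0 [l0 gl gp gq _] ep qe.
have flip s t : codist A (g s) <= codist A (g t) + `|s - t|.
  by rewrite (le_trans (codist_lip _ (g t) A0))// lerD2l.
rewrite -gp in ep; rewrite -gq in qe.
have [t [/andP[t0 tl] te ge]] := first_level l0 flip ep qe.
by exists t; split=> //; rewrite t0.
Qed.

Lemma lip1_continuous g : lip1 g -> continuous g.
Proof.
move=> gl x; apply/(@cvgrPdist_lt R) => e e0; near=> t.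
by rewrite (le_lt_trans (gl _ _))//; near: t; exact: (@cvgr_dist_lt _ _ _ _ _ id x).
Unshelve. all: by end_near. Qed.

(** A partition of [[0, t]] only sees the increments of the curve, which
    telescope against the increments of the parameter. *)
Lemma curve_length_lip (k t : R) g : 0 <= k -> 0 <= t ->
  (forall u v : R, `|g u - g v| <= k * `|u - v|) ->
  (curve_length 0 t g <= (k * t)%:E)%E.
Proof.
move=> k0 t0 gk; apply: ge_ereal_sup => _ [s st <-]; rewrite lee_fin.
suff H a : itv_partition a t s -> \sum_(0 <= i < size s)
    `|g (nth t (a :: s) i.+1) - g (nth t (a :: s) i)| <= k * (t - a).
  by rewrite (le_trans (H _ st))// subr0.
elim: s a {st} => [|x s IH] a.
  by move/itv_partition_nil->; rewrite big_nil subrr mulr0.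
move=> st; rewrite big_nat_recl//=.
have := IH x (itv_partition_cons st) => /= ih.
rewrite (le_trans (lerD (gk _ _) ih))//.
case: st => /= /andP[ax _] _.
by rewrite ger0_norm ?subr_ge0 ?(ltW ax)// -mulrDr addrC addrA subrK.
Qed.

(** Parametrizing by arc length turns the John inequality into the inclusion in
    the domain of the discs whose radius is proportional to the time. *)
Lemma john_domain_of_arcs (C : R) z0 A : 0 < C -> open A -> A z0 ->
  (forall z, A z -> exists l g, arc_in A l z z0 g /\
     forall t, 0 <= t <= l -> forall q, `|g t - q| < t / C -> A q) ->
  john_domain C z0 A.
Proof.
move=> C0 oA Az0 H; split=> //.
- split=> //; last by exists z0.
  have -> : A = \bigcup_(B in [set B | [/\ B `<=` A, B z0 & connected B]]) B.
    apply/seteqP; split=> [z Az|z [B [BA _ _] Bz]]; last exact: BA.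
    have [l [g [[l0 gl g0 ge gA] _]]] := H z Az.
    exists (g @` `[0, l]).
      split.
      - by move=> _ [t + <-]; rewrite /= in_itv => /gA.
      - by exists l => //=; rewrite in_itv /= l0 lexx.
      - apply: connected_continuous_connected; first exact: segment_connected.
        by apply: continuous_subspaceT => x; exact: lip1_continuous.
    by exists 0 => //=; rewrite in_itv /= lexx l0.
  apply: bigcup_connected; last by move=> B [].
  by exists z0 => B [].
- move=> z Az; have [l [g [[l0 gl g0 ge gA] gC]]] := H z Az.
  pose h (t : R) := g (l * t).
  have hl u v : `|h u - h v| <= l * `|u - v|.
    by rewrite (le_trans (gl _ _))// -mulrBr normrM (ger0_norm l0).
  have tl (t : R) : t \in `[0, 1] -> 0 <= l * t <= l.
    by rewrite in_itv /= => /andP[t0 t1]; rewrite mulr_ge0// ler_piMr.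
  exists h; split.
  + split; rewrite /h ?mulr0 ?mulr1//; last by move=> t /tl; exact: gA.
    apply: continuous_subspaceT => x; apply: continuous_comp.
      exact: mulrl_continuous.
    exact: lip1_continuous.
  + by rewrite /rectifiable (le_lt_trans (curve_length_lip l0 ler01 hl))// ltry.
  + move=> t t01; have := t01; rewrite in_itv /= => /andP[t0 t1].
    rewrite (le_trans (curve_length_lip l0 t0 hl))//.
    have := dist_boundary_ge oA (gC _ (tl _ t01)).
    move/(lee_wpmul2l (_ : 0%E <= C%:E)%E); rewrite lee_fin (ltW C0) => /(_ isT).
    by rewrite -EFinM mulrC divfK ?gt_eqF.
Qed.

End arcs.

(** * Winding of sampled loops in the plane *)

Section plane.
Context {R : realType}.
Local Notation C := (Rcomplex R).
Implicit Types (z u v w : C).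

Definition re z : R := complex.Re z.
Definition im z : R := complex.Im z.
Definition pt (a b : R) : C := Complex a b.

Lemma reD u v : re (u + v) = re u + re v. Proof. by case: u; case: v. Qed.
Lemma imD u v : im (u + v) = im u + im v. Proof. by case: u; case: v. Qed.
Lemma reB u v : re (u - v) = re u - re v. Proof. by case: u; case: v. Qed.
Lemma imB u v : im (u - v) = im u - im v. Proof. by case: u; case: v. Qed.
Lemma reZ (a : R) u : re (a *: u) = a * re u. Proof. by case: u. Qed.
Lemma imZ (a : R) u : im (a *: u) = a * im u. Proof. by case: u. Qed.

Lemma plane_eq u v : re u = re v -> im u = im v -> u = v.
Proof. by case: u; case: v => a b c d; rewrite /re /im /= => -> ->. Qed.

Lemma normE z : `|z| = Num.sqrt (re z ^+ 2 + im z ^+ 2).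
Proof. by case: z. Qed.

Lemma normE2 z : `|z| ^+ 2 = re z ^+ 2 + im z ^+ 2.
Proof. by rewrite normE sqr_sqrtr// addr_ge0 ?sqr_ge0. Qed.

Lemma re_le z : `|re z| <= `|z|.
Proof. by rewrite normE -sqrtr_sqr ler_wsqrtr// lerDl sqr_ge0. Qed.

Lemma im_le z : `|im z| <= `|z|.
Proof. by rewrite normE -sqrtr_sqr ler_wsqrtr// lerDr sqr_ge0. Qed.

Lemma norm_le_coord z : `|z| <= `|re z| + `|im z|.
Proof.
rewrite -(@ler_pXn2r _ 2) ?nnegrE ?addr_ge0// normE2 sqrrD !real_normK ?num_real//.
by rewrite lerD2r lerDl mulrn_wge0// mulr_ge0.
Qed.

Definition dotp u v : R := re u * re v + im u * im v.

Lemma dotp_near k u v :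
  `|k - u| < `|k| / 4 -> `|k - v| < `|k| / 4 -> 0 < dotp u v.
Proof.
move=> ku kv.
have e : `|u - v| ^+ 2 = `|u| ^+ 2 + `|v| ^+ 2 - 2 * dotp u v.
  by rewrite !normE2 reB imB /dotp; ring.
have uv : `|u - v| <= `|k - u| + `|k - v| by rewrite (distrC k) ler_distD.
have hu : `|k| <= `|k - u| + `|u| by rewrite -{1}(subrK u k) ler_normD.
have hv : `|k| <= `|k - v| + `|v| by rewrite -{1}(subrK v k) ler_normD.
have := normr_ge0 (u - v); nra.
Qed.

(** Each half-axis belongs to the quadrant that follows it counterclockwise;
    the last case also receives the origin. *)
Definition quadrant z : nat :=
  if (0 < re z) && (0 <= im z) then 0
  else if (re z <= 0) && (0 < im z) then 1
  else if (re z < 0) && (im z <= 0) then 2 else 3.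

Definition opposite (a b : nat) := b == ((a + 2) %% 4)%N.

Definition turn (a b : nat) : int :=
  if b == a then 0 else if b == ((a + 1) %% 4)%N then 1
  else if a == ((b + 1) %% 4)%N then -1 else 0.

Lemma quadrant_lt4 z : (quadrant z < 4)%N.
Proof. by rewrite /quadrant; do 3 case: ifP => // _. Qed.

Lemma dotp_opposite u v : 0 < dotp u v -> ~~ opposite (quadrant u) (quadrant v).
Proof.
rewrite /dotp /quadrant.
move: (re u) (im u) (re v) (im v) => a b c d.
by case: (ltrgtP 0 a) => ?; case: (ltrgtP 0 b) => ?;
   case: (ltrgtP 0 c) => ?; case: (ltrgtP 0 d) => ? //=; subst; nra.
Qed.

(** Three quadrants no two of which are opposite lie among two consecutive ones,
    so that turning through the middle one does not go around the origin. *)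
Lemma turn_triangle a b c : (a < 4)%N -> (b < 4)%N -> (c < 4)%N ->
  ~~ opposite a b -> ~~ opposite b c -> ~~ opposite a c ->
  turn a b + turn b c = turn a c.
Proof.
by case: a => [|[|[|[|?]]]] //; case: b => [|[|[|[|?]]]] //;
   case: c => [|[|[|[|?]]]].
Qed.

Lemma turnn a : turn a a = 0. Proof. by rewrite /turn eqxx. Qed.

(** Going around a cell of the grid in the two ways between opposite corners
    gives the same total turn, so that the turns along the vertical sides
    telescope and the first and the last column cancel. *)
Lemma turn_grid n (q : nat -> nat -> nat) :
  (forall i j, (q i j < 4)%N) ->
  (forall i j i' j', (i <= i' <= i.+1)%N -> (j <= j' <= j.+1)%N ->
     (i' <= n)%N -> (j' <= n)%N -> ~~ opposite (q i j) (q i' j')) ->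
  (forall i, (i <= n)%N -> q i 0 = q i n) ->
  \sum_(0 <= j < n) turn (q 0 j) (q 0 j.+1) =
  \sum_(0 <= j < n) turn (q n j) (q n j.+1).
Proof.
move=> q4 qop qper.
suff H i : (i <= n)%N -> \sum_(0 <= j < n) turn (q 0 j) (q 0 j.+1) =
    \sum_(0 <= j < n) turn (q i j) (q i j.+1) by exact: H.
elim: i => // i IH lin; rewrite IH ?(ltnW lin)//.
apply/eqP; rewrite -subr_eq0 -sumrB.
have T a b c d e f :=
  @turn_triangle (q a b) (q c d) (q e f) (q4 _ _) (q4 _ _) (q4 _ _).
have cell j : (0 <= j < n)%N ->
    turn (q i j) (q i j.+1) - turn (q i.+1 j) (q i.+1 j.+1) =
    - (turn (q i j.+1) (q i.+1 j.+1) - turn (q i j) (q i.+1 j)).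
  move=> /andP[_ jn].
  have := T i j i j.+1 i.+1 j.+1; have := T i j i.+1 j i.+1 j.+1.
  rewrite !qop ?leqnn ?leqnSn ?(ltnW lin) ?(ltnW jn)// => /(_ isT isT isT) e1.
  by move=> /(_ isT isT isT); rewrite -e1 => e2; lia.
rewrite (eq_big_nat _ _ cell) sumrN telescope_sumr//.
by rewrite (qper i) ?(ltnW lin)// (qper i.+1)// subrr oppr0.
Qed.

Definition unit_square : set (R * R) := `[0, 1] `*` `[0, 1].

Lemma unit_squareP (s t : R) : unit_square (s, t) <-> (0 <= s <= 1) && (0 <= t <= 1).
Proof. by rewrite /unit_square /= !in_itv /=; split=> [[-> ->]|/andP]. Qed.

(** Uniform continuity on the square, in the form in which it is needed: since
    the map avoids the origin, its values at close points span an acute angle. *)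
Lemma unit_square_acute (K : R * R -> C) :
  {within unit_square, continuous K} -> (forall p, unit_square p -> K p != 0) ->
  exists2 d : R, 0 < d & forall p q, unit_square p -> unit_square q ->
    `|p.1 - q.1| < d -> `|p.2 - q.2| < d -> 0 < dotp (K p) (K q).
Proof.
move=> Kc K0.
pose P (d : R) (p : R * R) := forall q, unit_square q ->
    `|p.1 - q.1| < d -> `|p.2 - q.2| < d -> 0 < dotp (K p) (K q).
have /compact_near_coveringP/near_covering_withinP cpt : compact unit_square.
  by apply: compact_setX; exact: segment_compact.
have : \forall d \near (0:R)^'+, unit_square `<=` P d.
  apply: cpt => x Sx.
  have /subspace_continuousP/(_ x Sx)/cvgrPdist_lt := Kc.
  have Kx0 : 0 < `|K x| / 4 by rewrite divr_gt0 ?normr_gt0 ?K0.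
  move=> /(_ _ Kx0); rewrite near_withinE => /nbhs_ballP[e /= e0 eP].
  exists (ball x (e / 2), [set d | d < e / 2]).
    split; first by apply: nbhsx_ballx; rewrite divr_gt0.
    by apply: nbhs_right_lt; rewrite divr_gt0.
  move=> [p d] /= [[px1 px2] de] Sp q Sq pq1 pq2.
  have e2 : e = e / 2 + e / 2 by rewrite -mulrDl -mulr2n -[e *+ 2]mulr_natr mulfK.
  apply: (@dotp_near (K x)).
    by apply: eP => //; split; apply: le_ball (_ : e / 2 <= e) _ _ => //;
      rewrite ler_pdivrMr// ler_pMr// ler1n.
  apply: eP => //; split; rewrite /= e2;
    [apply: (ball_triangle px1) | apply: (ball_triangle px2)].
    by rewrite -ball_normE /=; exact: lt_trans de.
  by rewrite -ball_normE /=; exact: lt_trans de.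
move=> H.
have [d [dP d0]] : exists d, unit_square `<=` P d /\ 0 < d.
  by near (0 : R)^'+ => d; exists d; split; near: d => //; exact: nbhs_right_gt.
by exists d => // p q Sp Sq; exact: dP.
Unshelve. all: by end_near. Qed.

(** The signed number of quadrants through which [n + 1] samples of a loop pass:
    four times its winding number about the origin if the sampling is fine. *)
Definition winding (n : nat) (g : R -> C) : int := \sum_(0 <= j < n)
  turn (quadrant (g (j%:R / n%:R))) (quadrant (g (j.+1%:R / n%:R))).

(** On a grid finer than the scale given by [unit_square_acute], neighbouring
    samples of the homotopy are never in opposite quadrants, and [turn_grid]
    applies. *)
Lemma winding_homotopy (K : R * R -> C) :
  {within unit_square, continuous K} -> (forall p, unit_square p -> K p != 0) ->
  (forall s : R, 0 <= s <= 1 -> K (s, 0) = K (s, 1)) ->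
  exists n0 : nat, forall n : nat, (n0 < n)%N ->
    winding n (fun t => K (0, t)) = winding n (fun t => K (1, t)).
Proof.
move=> Kc K0 Kper; have [d d0 dP] := unit_square_acute Kc K0.
exists (Num.truncn d^-1) => n n0n.
have n0 : (0 < n)%N by exact: leq_trans n0n.
have n0' : 0 < n%:R :> R by rewrite ltr0n.
have nd : (n%:R : R)^-1 < d.
  rewrite invf_plt ?posrE//; apply: lt_le_trans (Num.Theory.truncnS_gt _) _.
  by rewrite ler_nat.
pose q (i j : nat) := quadrant (K (i%:R / n%:R, j%:R / n%:R)).
have := @turn_grid n q.
rewrite /q /= mul0r divff ?gt_eqF//; apply.
- by move=> i j; exact: quadrant_lt4.
- move=> i j i' j' /andP[ii' i'i] /andP[jj' j'j] i'n j'n; apply: dotp_opposite.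
  have itv (k : nat) : (k <= n)%N -> 0 <= (k%:R / n%:R : R) <= 1.
    by move=> kn; rewrite divr_ge0// ler_pdivrMr// mul1r ler_nat.
  have close (k k' : nat) : (k <= k')%N -> (k' <= k.+1)%N ->
      `|k%:R / n%:R - k'%:R / n%:R| < d.
    move=> kk' k'k; rewrite -mulrBl normrM [`|_^-1|]ger0_norm// distrC.
    rewrite -natrB// normr_nat; apply: le_lt_trans nd.
    by rewrite ler_piMl ?invr_ge0// lern1 leq_subLR addn1.
  apply: dP; rewrite ?unit_squareP ?itv ?(leq_trans ii') ?(leq_trans jj')//=;
    exact: close.
- move=> i lein; rewrite Kper//.
  by rewrite divr_ge0// ler_pdivrMr// mul1r ler_nat.
Qed.

End plane.

(** * The square loop *)

Section square_loop.
Context {R : realType}.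
Local Notation C := (Rcomplex R).
Implicit Types (z u v w : C) (s t : R).

Lemma maxr_dist (n a b c d : R) :
  `|a - c| <= n -> `|b - d| <= n -> `|Num.max a b - Num.max c d| <= n.
Proof.
rewrite !ler_norml => /andP[? ?] /andP[? ?]; apply/andP.
by case: (leP a b) => ?; case: (leP c d) => ?; split; lra.
Qed.

Lemma minr_dist (n a b c d : R) :
  `|a - c| <= n -> `|b - d| <= n -> `|Num.min a b - Num.min c d| <= n.
Proof.
rewrite !ler_norml => /andP[? ?] /andP[? ?]; apply/andP.
by case: (leP a b) => ?; case: (leP c d) => ?; split; lra.
Qed.

(** Clamping to [[-1, 1]] lets one formula describe all four sides of a square. *)
Definition clamp t : R := Num.max (-1) (Num.min 1 t).

Lemma clamp_lip s t : `|clamp s - clamp t| <= `|s - t|.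
Proof. by apply: maxr_dist; last apply: minr_dist; rewrite ?subrr ?normr0. Qed.

Lemma clamp_ge1 t : 1 <= t -> clamp t = 1.
Proof. by move=> t1; rewrite /clamp min_l// max_r//; lra. Qed.

Lemma clamp_leN1 t : t <= -1 -> clamp t = -1.
Proof. by move=> t1; rewrite /clamp min_r ?max_l//; lra. Qed.

Lemma clamp_id t : -1 <= t <= 1 -> clamp t = t.
Proof. by move=> /andP[? ?]; rewrite /clamp min_r ?max_r. Qed.

Lemma clamp_le1 t : `|clamp t| <= 1.
Proof.
have [t1|t1] := leP 1 t; first by rewrite clamp_ge1// normr1.
have [t2|t2] := leP t (-1); first by rewrite clamp_leN1// normrN1.
by rewrite clamp_id ?ler_norml; apply/andP; split; lra.
Qed.

(** The boundary of the square [[-1, 1] x [-1, 1]], run through counterclockwise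
    at unit speed during [[0, 8]] from the middle of its right side; the corners
    are reached at the odd times. *)
Definition square t : C :=
  pt (clamp (`|t - 4| - 2)) (clamp (Num.max (2 - `|t - 2|) (t - 8))).

Lemma square_lip s t : `|square s - square t| <= 2 * `|s - t|.
Proof.
rewrite mulr_natl mulr2n (le_trans (norm_le_coord _))//.
rewrite reB imB /re /im /=; apply: lerD; rewrite (le_trans (clamp_lip _ _))//.
  rewrite opprB addrA subrK (le_trans (ler_dist_dist _ _))//.
  by rewrite opprB addrA subrK.
apply: maxr_dist; last by rewrite opprB addrA subrK.
rewrite opprB addrC addrA subrK distrC (le_trans (ler_dist_dist _ _))//.
by rewrite opprB addrA subrK.
Qed.

Lemma square_continuous : continuous square.
Proof.
move=> x; apply/(@cvgrPdist_lt R) => e e0; near=> t.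
rewrite (le_lt_trans (square_lip _ _))// mulrC -ltr_pdivlMr//; near: t.
by apply: (@cvgr_dist_lt _ _ _ _ _ id x); rewrite // divr_gt0.
Unshelve. all: by end_near. Qed.

Lemma square_right t : t <= 1 -> square t = pt 1 (clamp t).
Proof.
move=> t1; rewrite /square [`|t - 4|]ler0_norm; last by lra.
rewrite [`|t - 2|]ler0_norm ?max_l; [|lra|lra].
by rewrite clamp_ge1; [congr (pt _ (clamp _)); ring | lra].
Qed.

Lemma square_top t : 1 <= t <= 3 -> square t = pt (2 - t) 1.
Proof.
move=> /andP[t1 t3]; rewrite /square [`|t - 4|]ler0_norm; last by lra.
rewrite [clamp (Num.max _ _)]clamp_ge1 ?le_max.
  by rewrite clamp_id; [congr pt; ring | apply/andP; split; lra].
apply/orP; left; rewrite lerBrDl -lerBrDr ler_norml; apply/andP; split; lra.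
Qed.

Lemma square_left t : 3 <= t <= 5 -> square t = pt (-1) (4 - t).
Proof.
move=> /andP[t1 t3]; rewrite /square clamp_leN1.
  rewrite ger0_norm ?max_l; [|lra|lra].
  by rewrite clamp_id; [congr pt; ring | apply/andP; split; lra].
by rewrite lerBlDr ler_norml; apply/andP; split; lra.
Qed.

Lemma square_bottom t : 5 <= t <= 7 -> square t = pt (t - 6) (-1).
Proof.
move=> /andP[t1 t3]; rewrite /square [`|t - 4|]ger0_norm; last by lra.
rewrite [`|t - 2|]ger0_norm; last by lra.
rewrite [clamp (Num.max _ _)]clamp_leN1 ?ge_max; last by apply/andP; split; lra.
by rewrite clamp_id; [congr pt; ring | apply/andP; split; lra].
Qed.

Lemma square_right' t : 7 <= t -> square t = pt 1 (clamp (t - 8)).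
Proof.
move=> t1; rewrite /square ger0_norm; last by lra.
rewrite [`|t - 2|]ger0_norm ?max_r; [|lra|lra].
by rewrite clamp_ge1//; lra.
Qed.

Lemma square_loop : square 8 = square 0.
Proof. by rewrite square_right' ?square_right ?subrr// ler_nat. Qed.

(** The norm whose spheres are the boundaries of the squares. *)
Definition supn z : R := Num.max `|re z| `|im z|.

Lemma supn_lip u v : `|supn u - supn v| <= `|u - v|.
Proof.
apply: maxr_dist; rewrite (le_trans (ler_dist_dist _ _))//.
  by rewrite -reB re_le.
by rewrite -imB im_le.
Qed.

Lemma supnZ (a : R) z : 0 <= a -> supn (a *: z) = a * supn z.
Proof. by move=> a0; rewrite /supn reZ imZ !normrM ger0_norm// maxr_pMr. Qed.

Lemma supn_square t : supn (square t) = 1.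
Proof.
rewrite /supn.
have [t1|t1] := leP t 1; first by rewrite square_right// normr1 max_l// clamp_le1.
have [t3|t3] := leP t 3.
  rewrite square_top ?(ltW t1)// /re /im /= normr1 max_r//.
  by rewrite ler_norml; apply/andP; split; lra.
have [t5|t5] := leP t 5.
  rewrite square_left ?(ltW t3)// /re /im /= normrN1 max_l//.
  by rewrite ler_norml; apply/andP; split; lra.
have [t7|t7] := leP t 7.
  rewrite square_bottom ?(ltW t5)// /re /im /= normrN1 max_r//.
  by rewrite ler_norml; apply/andP; split; lra.
by rewrite square_right' ?(ltW t7)// normr1 max_l// clamp_le1.
Qed.

Lemma quadrant_square (k : nat) t : (k < 4)%N ->
  (2 * k)%:R <= t < (2 * k.+1)%:R -> quadrant (square t) = k.
Proof.
have cge (u : R) : 0 <= u -> 0 <= clamp u.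
  by move=> u0; rewrite /clamp le_max le_min ler01 u0 orbT.
have clt (u : R) : u < 0 -> clamp u < 0.
  by move=> u0; rewrite /clamp gt_max gt_min u0 orbT andbT; lra.
case: k => [|[|[|[|]]]]// _ /andP[t0 t1].
- have [h|h] := leP t 1.
    by rewrite square_right// /quadrant /= ltr01 cge//; lra.
  rewrite square_top /quadrant /re /im /=; last by apply/andP; split; lra.
  by rewrite ler01 andbT ifT//; lra.
- have [h|h] := leP t 3.
    rewrite square_top /quadrant /re /im /=; last by apply/andP; split; lra.
    by rewrite ifF ?ifT//; [apply/andP; split; lra | apply/negP => /andP[]; lra].
  rewrite square_left /quadrant /re /im /=; last by apply/andP; split; lra.
  by rewrite ifF ?ifT//; [apply/andP; split; lra | apply/negP => /andP[]; lra].
- have [h|h] := leP t 5.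
    rewrite square_left /quadrant /re /im /=; last by apply/andP; split; lra.
    rewrite ifF; last by apply/negP => /andP[]; lra.
    rewrite ifF; last by apply/negP => /andP[]; lra.
    by rewrite ifT//; apply/andP; split; lra.
  rewrite square_bottom /quadrant /re /im /=; last by apply/andP; split; lra.
  rewrite ifF; last by apply/negP => /andP[]; lra.
  rewrite ifF; last by apply/negP => /andP[]; lra.
  by rewrite ifT//; apply/andP; split; lra.
- have [h|h] := leP t 7.
    rewrite square_bottom /quadrant /re /im /=; last by apply/andP; split; lra.
    rewrite ifF; last by apply/negP => /andP[]; lra.
    rewrite ifF; last by apply/negP => /andP[]; lra.
    by rewrite ifF//; apply/negP => /andP[]; lra.
  have c0 : clamp (t - 8) < 0 by apply: clt; lra.
  rewrite square_right' /quadrant /re /im /=; last exact: ltW.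
  rewrite ifF; last by apply/negP => /andP[]; lra.
  rewrite ifF; last by apply/negP => /andP[]; lra.
  by rewrite ifF//; apply/negP => /andP[]; lra.
Qed.

Lemma quadrantZ (a : R) z : 0 < a -> quadrant (a *: z) = quadrant z.
Proof.
move=> a0; rewrite /quadrant reZ imZ !pmulr_rgt0// !pmulr_rge0//.
by rewrite !pmulr_rle0// !pmulr_rlt0.
Qed.

(** With [4 * m] samples the quadrant of the sample [j] is [j %/ m] modulo 4, so
    the turns telescope to [4 * m %/ m]. *)
Lemma winding_square (m : nat) (rho : R) : (0 < m)%N -> 0 < rho ->
  winding (4 * m) (fun t => rho *: square (8 * t)) = 4.
Proof.
move=> m0 rho0; rewrite /winding.
have m0' : 0 < m%:R :> R by rewrite ltr0n.
have quadE j : (j <= 4 * m)%N ->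
    quadrant (rho *: square (8 * (j%:R / (4 * m)%:R))) = ((j %/ m) %% 4)%N.
  move=> jm; rewrite quadrantZ//.
  have -> : 8 * (j%:R / (4 * m)%:R) = 2 * j%:R / m%:R :> R.
    by rewrite natrM; field; rewrite gt_eqF.
  have [jm4|jm4] := ltnP j (4 * m)%N; last first.
    have -> : j = (4 * m)%N by apply/eqP; rewrite eqn_leq jm.
    rewrite natrM mulrA mulfK ?gt_eqF// mulnK//= square_right'; last by lra.
    by rewrite /quadrant /re /im /= ltr01 clamp_id ?ifT//; apply/andP; split; lra.
  have lt4 : (j %/ m < 4)%N by rewrite ltn_divLR.
  rewrite modn_small// (@quadrant_square (j %/ m))//.
  rewrite !natrM ler_pdivlMr// ltr_pdivrMr// -!mulrA ler_pM2l// ltr_pM2l//.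
  by rewrite -!natrM ler_nat ltr_nat leq_trunc_div ltn_ceil.
have stepE j : (0 <= j < 4 * m)%N ->
    turn (quadrant (rho *: square (8 * (j%:R / (4 * m)%:R))))
         (quadrant (rho *: square (8 * (j.+1%:R / (4 * m)%:R)))) =
    (j.+1 %/ m)%:Z - (j %/ m)%:Z.
  move=> /andP[_ jm]; rewrite !quadE//; last exact: ltnW.
  have [] : (j.+1 %/ m = j %/ m)%N \/ (j.+1 %/ m = (j %/ m).+1)%N.
  + have [m1|m1] := leqP m 1.
      by right; have -> : m = 1%N; [apply/eqP; rewrite eqn_leq m1 | rewrite !divn1].
    rewrite -addn1 divnD// (divn_small m1) addn0.
    by case: leqP => _; rewrite ?addn0 ?addn1; [right | left].
  + by move->; rewrite turnn subrr.
  + move->; rewrite /turn; have : (j %/ m < 4)%N by rewrite ltn_divLR.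
    by case: (j %/ m)%N => [|[|[|[|?]]]].
rewrite (eq_big_nat _ _ stepE) telescope_sumr//.
by rewrite mulnK// div0n subr0.
Qed.

End square_loop.

(** * Squares around an omitted point leave a simply connected set *)

Section escape.
Context {R : realType}.
Local Notation C := (Rcomplex R).
Implicit Types (O : set C) (w x : C).

(** A square loop inside the domain would be null-homotopic away from the
    omitted point [x], while sliding its center from [w] to [x] shows that it
    winds once around [x]. *)
Lemma square_escapes O w x (rho : R) : simply_connected R O -> ~ O x ->
  supn (x - w) < rho -> exists2 t : R, 0 <= t <= 8 & ~ O (w + rho *: square t).
Proof.
move=> [_ sc] Ox xw.
have rho0 : 0 < rho.
  by rewrite (le_lt_trans _ xw)// /supn le_max normr_ge0.
apply: contrapT => nex.
have Osq (t : R) : 0 <= t <= 8 -> O (w + rho *: square t).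
  by move=> t8; apply: contrapT => nO; apply: nex; exists t.
pose g (t : R) := w + rho *: square (8 * t).
have gc : continuous g.
  move=> t; apply: cvgD; first exact: cvg_cst.
  apply: cvgZr.
  apply: (@continuous_comp _ _ _ (fun t : R => 8 * t) square).
    exact: mulrl_continuous.
  exact: square_continuous.
have g01 : g 1 = g 0.
  by rewrite /g mulr1 mulr0 square_loop.
have [] := sc (g 0) g.
  split=> //; first by apply: continuous_subspaceT => t; exact: gc.
  move=> t; rewrite in_itv /= => /andP[t0 t1]; apply: Osq.
  by rewrite mulr_ge0//=; lra.
move=> H [Hc HO H0 H1 Hs].
pose K1 (p : R * R) := H p - x.
pose K2 (p : R * R) := rho *: square (8 * p.2) - p.1 *: (x - w).
have [|||n1 W1] := @winding_homotopy R K1.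
- apply/subspace_continuousP => p Sp; apply: cvgB; last exact: cvg_cst.
  by move/subspace_continuousP : Hc; exact.
- move=> [s t] [/= s01 t01]; rewrite subr_eq0; apply/eqP => Hx.
  by apply: Ox; rewrite -Hx; exact: HO.
- move=> s s01; rewrite /K1; have [|-> ->//] := Hs s.
  by rewrite in_itv.
have [|||n2 W2] := @winding_homotopy R K2.
- apply: continuous_subspaceT => p; apply: cvgB.
    apply: cvgZr; apply: (@continuous_comp _ _ _ (fun q : R * R => 8 * q.2) square).
      apply: cvgM; [exact: cvg_cst | exact: cvg_snd].
    exact: square_continuous.
  by apply: cvgZl; exact: cvg_fst.
- move=> [s t] /unit_squareP/andP[/andP[s0 s1] _]; rewrite subr_eq0 /=.
  apply/eqP => /(congr1 supn); rewrite !supnZ ?(ltW rho0)// supn_square mulr1.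
  have : 0 <= supn (x - w) by rewrite /supn le_max normr_ge0.
  by move=> sup0 e; move: xw; rewrite e ltNge ler_piMl.
- move=> s _; rewrite /K2 /=.
  by rewrite mulr1 mulr0 square_loop.
pose m := (n1 + n2).+1.
have n4 : (n1 + n2 < 4 * m)%N by rewrite /m; lia.
have := W2 (4 * m)%N; rewrite (leq_ltn_trans _ n4) ?leq_addl// => /(_ isT).
have := W1 (4 * m)%N; rewrite (leq_ltn_trans _ n4) ?leq_addr// => /(_ isT).
have -> : winding (4 * m) (fun t : R => K2 (0, t)) = 4.
  rewrite -(@winding_square R m rho)//; congr (winding _ _).
  by apply/funext => t; rewrite /K2 /= scale0r subr0.
have itv (j : nat) : (j <= 4 * m)%N -> (j%:R / (4 * m)%:R : R) \in `[0, 1].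
  by move=> jm; rewrite in_itv /= divr_ge0// ler_pdivrMr ?ltr0n// mul1r ler_nat.
have -> : winding (4 * m) (fun t : R => K1 (1, t)) = 0.
  rewrite /winding big_nat_cond big1// => j /andP[/andP[_ jm] _].
  by rewrite /K1 !H1 ?turnn ?itv// ltnW.
have -> : winding (4 * m) (fun t : R => K1 (0, t)) =
          winding (4 * m) (fun t : R => K2 (1, t)).
  rewrite /winding; apply: eq_big_nat => j /andP[_ jm].
  rewrite /K1 /K2 !H0 ?itv ?(ltnW jm)// /g /= !scale1r !opprB.
  by rewrite ![_ + (w - x)]addrCA !addrA.
by move=> ->.
Qed.

End escape.

(** * Branching *)

Section branching.
Context {R : realType}.
Local Notation C := (Rcomplex R).
Implicit Types (O : set C) (w x : C).

Lemma arc_in_deep O e l p q (g : R -> C) : ~` O !=set0 ->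
  arc_in setT l p q g -> e + l <= codist O p ->
  arc_in [set x | e <= codist O x] l p q g.
Proof.
move=> O0 [l0 gl gp gq _] ep; split=> // t /andP[t0 tl] /=.
have := codist_lip p (g t) O0.
have := gl 0 t; rewrite gp sub0r normrN (ger0_norm t0); lra.
Qed.

Lemma vertical_arc w (a l : R) : 0 <= l ->
  arc_in setT l (w + pt a 0) (w + pt a l) (fun t => w + pt a t).
Proof.
move=> l0; split=> // s t.
rewrite opprD addrACA subrr add0r (le_trans (norm_le_coord _))//.
by rewrite reB imB /re /im /= subrr normr0 add0r.
Qed.

Lemma square_arc w (rho t0 t1 : R) : 0 < rho -> 0 <= t0 <= 8 -> 0 <= t1 <= 8 ->
  arc_in setT (16 * rho) (w + rho *: square t0) (w + rho *: square t1)
    (fun u => w + rho *: square (t0 + (t1 - t0) * (u / (16 * rho)))).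
Proof.
move=> rho0 /andP[? ?] /andP[? ?]; have rho16 : 0 < 16 * rho by rewrite mulr_gt0.
split=> //; first exact: ltW.
- move=> s t; rewrite opprD addrACA subrr add0r -scalerBr normrZ (gtr0_norm rho0).
  apply: (@le_trans _ _ (rho * (2 * (8 * (`|s - t| / (16 * rho)))))).
    rewrite ler_pM2l// (le_trans (square_lip _ _))// ler_pM2l//.
    rewrite opprD addrACA subrr add0r -mulrBr -mulrBl !normrM.
    rewrite [`|_^-1|]gtr0_norm ?invr_gt0//.
    apply: ler_wpM2r; first by rewrite divr_ge0 ?(ltW rho16).
    by rewrite ler_norml; apply/andP; split; lra.
  rewrite le_eqVlt; apply/orP; left; apply/eqP; field.
  by rewrite gt_eqF.
- by rewrite mul0r mulr0 addr0.
- by rewrite divff ?gt_eqF// mulr1 [t0 + _]addrC subrK.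
Qed.

Definition linked O (e l : R) w p :=
  exists l' g, l' <= l /\ arc_in [set x | e <= codist O x] l' w p g.

(** Shoot vertical rays from equally spaced points of a horizontal radius of the
    disc of radius [r] about [w]. If each of them comes within [e * r] of the
    complement before height [2 * r], the first such points have distinct
    abscissas. Otherwise one ray is free up to that height, and from it one can
    go along the boundaries of concentric squares; each of these meets the
    complement by [square_escapes], so there is a first point within [e * r]
    of the complement on each of them. In both cases there are as many points
    as rays or squares. *)
Lemma branching O w (N : nat) (e : R) :
  ~` O !=set0 -> simply_connected R O -> 0 < codist O w -> (0 < N)%N ->
  0 < e <= 1 / 2 ->
  exists c : nat -> C,
    (forall i, (i < N)%N -> codist O (c i) = e * codist O w /\
       linked O (e * codist O w) (40 * codist O w) w (c i)) /\
    (forall i j, (i < N)%N -> (j < N)%N -> i <> j ->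
       codist O w / (2 * N%:R) <= `|c i - c j|).
Proof.
move=> O0 sc; set r := codist O w => r0 N0 /andP[e0 e1].
have N0' : 0 < N%:R :> R by rewrite ltr0n.
pose s (i : nat) : R := r / (2 * N%:R) * i%:R.
have s0 i : 0 <= s i by rewrite mulr_ge0 ?divr_ge0 ?mulr_ge0 ?(ltW r0).
have s1 i : (i < N)%N -> s i <= r / 2.
  move=> iN; rewrite /s mulrAC ler_pdivrMr ?mulr_gt0// mulrA divfK ?pnatr_eq0//.
  by rewrite ler_pM2l// ler_nat ltnW.
have ssep i j : i <> j -> r / (2 * N%:R) <= `|s i - s j|.
  move=> ij; rewrite -mulrBr normrM ger0_norm ?divr_ge0 ?mulr_ge0 ?(ltW r0)//.
  rewrite ler_peMr ?divr_ge0 ?mulr_ge0 ?(ltW r0)//.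
  have [ij'|ij'] := leqP i j.
    by rewrite distrC -natrB// normr_nat ler1n subn_gt0 ltn_neqAle ij' andbT; apply/eqP.
  by rewrite -natrB 1?ltnW// normr_nat ler1n subn_gt0.
have er : e * r <= r / 2 by rewrite [leRHS]mulrC ler_pM2r//; lra.
pose h i := w + pt (s i) 0.
have wh i : (i < N)%N -> exists2 g,
    arc_in [set x | e * r <= codist O x] `|h i - w| w (h i) g &
    `|h i - w| <= r / 2.
  move=> iN; have hw : `|h i - w| <= r / 2.
    rewrite /h addrC addKr (le_trans (norm_le_coord _))// /re /im /= normr0 addr0.
    by rewrite ger0_norm// s1.
  exists (segment_arc w (h i)) => //.
  by apply: arc_in_deep => //; [exact: segment_arcP | rewrite -/r; lra].
have hdeep i : (i < N)%N -> e * r <= codist O (h i).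
  move=> iN; have [g [l0 _ _ gh gA] _] := wh i iN.
  by have := gA `|h i - w|; rewrite l0 lexx gh; exact.
have [allhit|] := pselect (forall i, (i < N)%N ->
    exists2 t : R, 0 <= t <= 2 * r & codist O (w + pt (s i) t) <= e * r).
  have H i : exists p, (i < N)%N ->
      (codist O p = e * r /\ linked O (e * r) (40 * r) w p) /\ re (p - w) = s i.
    have [iN|] := boolP (i < N)%N; last by exists w.
    have [t /andP[t0 tr] te] := allhit i iN.
    have [g1 g1A l1] := wh i iN.
    have [t' [/andP[t'0 t't] t'e g2A]] :=
      arc_first_exit O0 (vertical_arc w (s i) t0) (hdeep i iN) te.
    exists (w + pt (s i) t') => _; split; last by rewrite addrC addKr.
    split=> //; exists (`|h i - w| + t'); eexists.
    split; last exact: arc_in_cat g1A g2A.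
    by lra.
  have [c cP] := choice H; exists c; split=> [i iN|i j iN jN ij].
    by have [] := cP i iN.
  have [_ ci] := cP i iN; have [_ cj] := cP j jN.
  rewrite (le_trans (ssep i j ij))// -ci -cj -reB.
  by rewrite opprB addrA subrK re_le.
move=> /existsNP[i0 /not_implyP[i0N nohit]].
have free (t : R) : 0 <= t <= 2 * r -> e * r <= codist O (w + pt (s i0) t).
  by move=> t2r; rewrite leNgt; apply/negP => /ltW te; apply: nohit; exists t.
(* The squares below have half-side more than [3 / 2 * r], so they surround [x]. *)
have [|x Ox xw] := @codist_near _ _ O w (3 / 2 * r) O0.
  by rewrite -/r; lra.
have H i : exists p, (i < N)%N ->
    (codist O p = e * r /\ linked O (e * r) (40 * r) w p) /\
    supn (p - w) = 2 * r - s i.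
  have [iN|] := boolP (i < N)%N; last by exists w.
  have si := s1 i iN; have si0 := s0 i; have s00 := s0 i0; have s01 := s1 i0 i0N.
  set rho := 2 * r - s i.
  have rho0 : 0 < rho by rewrite /rho; lra.
  have rho2 : rho <= 2 * r by rewrite /rho; lra.
  have [|t1 t18 t1O] := @square_escapes _ O w x rho sc Ox.
    have := supn_lip (x - w) 0.
    have sup0 : supn (0 : C) = 0 by rewrite /supn /re /im /= normr0 maxxx.
    rewrite sup0 !subr0 distrC ler_norml => /andP[_ ?].
    by rewrite /rho; lra.
  (* The time at which the square loop passes through the free ray. *)
  pose t0 := 2 - s i0 / rho.
  have sr : 0 <= s i0 / rho <= 1.
    by rewrite divr_ge0 ?(ltW rho0)//= ler_pdivrMr// mul1r /rho; lra.
  have t0E : w + rho *: square t0 = w + pt (s i0) rho.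
    rewrite square_top; last by rewrite /t0; lra.
    congr (_ + _); apply: plane_eq; rewrite ?reZ ?imZ /re /im /=; last by rewrite mulr1.
    by rewrite /t0 opprB addrCA subrr addr0 mulrC divfK ?gt_eqF.
  have [g1 g1A l1] := wh i0 i0N.
  have g2A : arc_in [set y | e * r <= codist O y] rho (h i0) (w + pt (s i0) rho)
      (fun t => w + pt (s i0) t).
    have [? ? ? ? _] := vertical_arc w (s i0) (ltW rho0).
    by split=> // t /andP[t0' tr]; apply: free; rewrite t0' (le_trans tr).
  have t0P : 0 <= t0 <= 8 by rewrite /t0; lra.
  have [|| t' [/andP[t'0 t't] t'e]] :=
    @arc_first_exit _ _ O _ (e * r) _ _ _ O0 (square_arc w rho0 t0P t18).
  - by rewrite t0E; apply: free; rewrite ltW.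
  - by rewrite codist_out// mulr_ge0 ?ltW.
  rewrite t0E => g3A.
  exists (w + rho *: square (t0 + (t1 - t0) * (t' / (16 * rho)))) => _.
  split; last first.
    by rewrite addrC addKr supnZ ?(ltW rho0)// supn_square mulr1.
  split; first exact: t'e.
  eexists; eexists; split; last exact: arc_in_cat (arc_in_cat g1A g2A) g3A.
  by lra.
have [c cP] := choice H; exists c; split=> [i iN|i j iN jN ij].
  by have [] := cP i iN.
have [_ ci] := cP i iN; have [_ cj] := cP j jN.
have := supn_lip (c i - w) (c j - w).
have -> : c i - w - (c j - w) = c i - c j by rewrite opprD opprK addrACA addNr addr0.
rewrite ci cj; apply: le_trans.
have -> : 2 * r - s i - (2 * r - s j) = s j - s i by ring.
by rewrite distrC ssep.
Qed.

End branching.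

(** * The tree of discs *)

Section john_tree.
Context {R : realType}.
Local Notation C := (Rcomplex R).
Context (O : set C) (z : C) (N : nat) (e L : R) (child : C -> nat -> C).
Context (O_co : ~` O !=set0) (O_open : open O) (Oz : O z) (N_gt0 : (0 < N)%N).
Context (e_gt0 : 0 < e) (e_le : e <= 1 / 4) (L_ge1 : 1 <= L).
Context (child_codist : forall w i, O w -> (i < N)%N ->
  codist O (child w i) = e * codist O w).
Context (child_linked : forall w i, O w -> (i < N)%N ->
  linked O (e * codist O w) (L * codist O w) w (child w i)).
Context (child_sep : forall w i j, O w -> (i < N)%N -> (j < N)%N -> i <> j ->
  9 * L * (e * codist O w) <= `|child w i - child w j|).
Implicit Types (m k : nat) (p q : C).

(** Generation [m] is indexed by the base [N] words of [m] digits, read as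
    numbers: removing the last digit gives the parent. *)
Fixpoint node m k : C :=
  if m is m'.+1 then child (node m' (k %/ N)) (k %% N) else z.

(** The distance to the complement at the nodes of generation [m]. *)
Definition clearance m : R := e ^+ m * codist O z.

Lemma L_gt0 : 0 < L. Proof. exact: lt_le_trans L_ge1. Qed.

Lemma codist_in_gt0 p : 0 < codist O p -> O p.
Proof. by move=> p0; apply: (@codist_in _ _ _ p); rewrite subrr normr0. Qed.

Lemma clearance_gt0 m : 0 < clearance m.
Proof. by rewrite mulr_gt0 ?exprn_gt0 ?codist_gt0. Qed.

Lemma clearanceS m : clearance m.+1 = e * clearance m.
Proof. by rewrite /clearance exprS mulrA. Qed.

Lemma clearanceS_le m : clearance m.+1 <= clearance m / 4.
Proof. by rewrite clearanceS [leRHS]mulrC ler_pM2r ?clearance_gt0// -div1r. Qed.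

Lemma node_codist m k : codist O (node m k) = clearance m.
Proof.
elim: m k => [|m IH] k /=; first by rewrite /clearance expr0 mul1r.
rewrite child_codist ?ltn_pmod//; first by rewrite IH clearanceS.
by apply: codist_in_gt0; rewrite IH clearance_gt0.
Qed.

Lemma node_in m k : O (node m k).
Proof. by apply: codist_in_gt0; rewrite node_codist clearance_gt0. Qed.

Lemma node_linked m k :
  linked O (clearance m.+1) (L * clearance m) (node m (k %/ N)) (node m.+1 k).
Proof.
rewrite clearanceS -(node_codist m (k %/ N)) /=.
by apply: child_linked; rewrite ?ltn_pmod//; exact: node_in.
Qed.

Lemma node_step m k : `|node m.+1 k - node m (k %/ N)| <= L * clearance m.
Proof.
have [l [g [lL /arc_in_dist]]] := node_linked m k.
by rewrite distrC => /le_trans; exact.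
Qed.

(** Thickening, by half of the clearance, of everything that can be reached from
    a node within the clearance and the length granted to its generation. *)
Definition tree_domain : set C := [set q | exists m k p,
  linked O (clearance m.+1) (L * clearance m) (node m k) p /\
  `|p - q| < clearance m.+1 / 2].

Lemma node_linked_refl m k :
  linked O (clearance m.+1) (L * clearance m) (node m k) (node m k).
Proof.
exists 0, (fun=> node m k); split.
  by rewrite mulr_ge0 ?(ltW (clearance_gt0 m))// (le_trans ler01).
split=> // [s t|t _ /=]; first by rewrite subrr normr0.
by rewrite node_codist (le_trans (clearanceS_le m))//; have := clearance_gt0 m; lra.
Qed.

Lemma node_tree m k : tree_domain (node m k).
Proof.
exists m, k, (node m k); split; first exact: node_linked_refl.
by rewrite subrr normr0 divr_gt0 ?clearance_gt0.
Qed.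

Lemma tree_domain_open : open tree_domain.
Proof.
rewrite openE => q [m [k [p [mp pq]]]].
apply/nbhs_ballP; exists (clearance m.+1 / 2 - `|p - q|); first by rewrite /= subr_gt0.
move=> q'; rewrite -ball_normE /= => qq'; exists m, k, p; split=> //.
by rewrite (le_lt_trans (ler_distD q _ _))// addrC -ltrBrDr.
Qed.

Lemma tree_domain_sub : tree_domain `<=` O.
Proof.
move=> q [m [k [p [[l [g [lL [l0 _ _ gl gA]]]] pq]]]].
have pA : clearance m.+1 <= codist O p by rewrite -gl; apply: gA; rewrite l0 lexx.
apply: (@codist_in _ _ _ p); rewrite (lt_le_trans pq)//.
by have := clearance_gt0 m.+1; lra.
Qed.

(** An arc issued from a node stays in the domain together with discs of a
    radius comparable to the clearance of its generation. When one goes back along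
    it and then from the node to the root, the margin [2 * L * clearance m] left by
    the node pays for the length of the arc. *)
Lemma linked_john m k p : linked O (clearance m.+1) (L * clearance m) (node m k) p ->
  (exists l g, arc_in tree_domain l (node m k) z g /\
     forall t : R, 0 <= t <= l -> forall q,
     `|g t - q| < e / (4 * L) * (t + 2 * L * clearance m) -> tree_domain q) ->
  exists l g, arc_in tree_domain l p z g /\
     forall t : R, 0 <= t <= l -> forall q,
     `|g t - q| < e / (4 * L) * (t + 2 * L * clearance m.+1) -> tree_domain q.
Proof.
move=> [l1 [g1 [l1L g1A]]] [l2 [g2 [g2A g2B]]].
have L0 := L_gt0.
have rm := clearance_gt0 m; have rm' := clearanceS_le m.
have cE (a : R) : e / (4 * L) * a <= clearance m.+1 / 2 <-> a <= 2 * L * clearance m.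
  rewrite clearanceS mulrAC ler_pdivrMr ?mulr_gt0//.
  have -> : e * clearance m / 2 * (4 * L) = e * (2 * L * clearance m) by field.
  by rewrite ler_pM2l.
have g1B (t : R) : 0 <= t <= l1 ->
    linked O (clearance m.+1) (L * clearance m) (node m k) (g1 t).
  case: g1A => l10 g1l g10 _ g1A /andP[t0 tl].
  exists t, g1; split; first exact: le_trans l1L.
  by split=> // s /andP[s0 st]; apply: g1A; rewrite s0 (le_trans st).
have g1T : arc_in tree_domain l1 (node m k) p g1.
  have [l10 g1l g10 g1e _] := g1A; split=> // t t1.
  exists m, k, (g1 t); split; first exact: g1B.
  by rewrite subrr normr0 divr_gt0 ?clearance_gt0.
exists (l1 + l2), (fun t => if t <= l1 then g1 (l1 - t) else g2 (t - l1)).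
split; first exact: arc_in_cat (arc_in_rev g1T) g2A.
move=> t /andP[t0 tl] q; case: (leP t l1) => tl1 gq.
  exists m, k, (g1 (l1 - t)); split; first by apply: g1B; rewrite subr_ge0 tl1 gerBl.
  rewrite (lt_le_trans gq)//; apply/cE.
  have : 2 * L * clearance m.+1 <= 2 * L * (clearance m / 4).
    by rewrite ler_pM2l ?mulr_gt0.
  lra.
apply: (g2B (t - l1)); first by rewrite subr_ge0 (ltW tl1)/= lerBlDl.
rewrite (lt_le_trans gq)// ler_pM2l ?divr_gt0 ?mulr_gt0//.
have : 2 * L * clearance m.+1 <= 2 * L * (clearance m / 4).
  by rewrite ler_pM2l ?mulr_gt0.
by have := mulr_gt0 L0 rm; lra.
Qed.

Lemma node_john m k : exists l g, arc_in tree_domain l (node m k) z g /\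
  forall t : R, 0 <= t <= l -> forall q,
  `|g t - q| < e / (4 * L) * (t + 2 * L * clearance m) -> tree_domain q.
Proof.
elim: m k => [|m IH] k; last by apply: linked_john (IH _); exact: node_linked.
exists 0, (fun=> z); split.
  split=> // [s t|t _]; first by rewrite subrr normr0.
  exact: (node_tree 0 0).
move=> t; rewrite -eq_le => /eqP <- q zq.
exists 0%N, 0%N, z; split; first exact: (node_linked_refl 0 0).
rewrite (lt_le_trans zq)// add0r clearanceS le_eqVlt; apply/orP; left; apply/eqP.
by field; rewrite gt_eqF ?L_gt0.
Qed.

(** From a point of a disc of the tree, first go to the center of that disc, then
    back along the tree. *)
Lemma tree_domain_john : john_domain (4 * L / e) z tree_domain.
Proof.
have L0 := L_gt0.
apply: john_domain_of_arcs.
- by rewrite divr_gt0 ?mulr_gt0.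
- exact: tree_domain_open.
- exact: (node_tree 0 0).
move=> q [m [k [p [mp pq]]]].
have [l2 [g2 [g2A g2B]]] := linked_john mp (node_john m k).
set l1 := `|p - q|.
have [_ g1l g10 g1e _] := segment_arcP q p.
have g1p (t : R) : t <= l1 -> `|p - segment_arc q p t| <= l1 - t.
  by move=> tl; rewrite -{1}g1e (le_trans (g1l _ _))// ger0_norm ?subr_ge0.
have g1T : arc_in tree_domain l1 q p (segment_arc q p).
  split; rewrite ?normr_ge0// => t /andP[t0 tl]; exists m, k, p; split=> //.
  by rewrite (le_lt_trans (g1p t tl))// (le_lt_trans _ pq)// gerBl.
exists (l1 + l2), (fun t => if t <= l1 then segment_arc q p t else g2 (t - l1)).
split; first exact: arc_in_cat g1T g2A.
have cE (t : R) : t / (4 * L / e) = e / (4 * L) * t by rewrite invf_div mulrC.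
have eL : e / (4 * L) <= 1.
  by rewrite ler_pdivrMr ?mulr_gt0// mul1r; have := L_ge1; have := e_le; lra.
move=> t /andP[t0 tl] q'; case: (leP t l1) => tl1; rewrite cE => gq.
  exists m, k, p; split=> //.
  rewrite (le_lt_trans (ler_distD (segment_arc q p t) _ _))//.
  have := g1p t tl1; have : e / (4 * L) * t <= t by rewrite ler_piMl.
  by move: pq; rewrite -/l1; lra.
apply: (g2B (t - l1)); first by rewrite subr_ge0 (ltW tl1)/= lerBlDl.
rewrite (lt_le_trans gq)// ler_pM2l ?divr_gt0 ?mulr_gt0//.
have : clearance m.+1 <= L * clearance m.+1.
  by rewrite ler_peMl ?(ltW (clearance_gt0 _)).
have := clearance_gt0 m.+1; move: pq; rewrite -/l1; lra.
Qed.

Lemma clearance_small (d : R) : 0 < d -> exists m, clearance m < d.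
Proof.
move=> d0; have r0 : 0 < codist O z by exact: codist_gt0.
pose m := Num.truncn (codist O z / d); exists m.
rewrite /clearance -ltr_pdivlMr// -invf_div.
have ed : codist O z / d < 2 ^+ m.
  rewrite (lt_le_trans (Num.Theory.truncnS_gt _))// -natrX ler_nat.
  exact: ltn_expl.
rewrite (le_lt_trans (y := (2 ^+ m)^-1))//; last first.
  by rewrite ltf_pV2 ?posrE ?divr_gt0 ?exprn_gt0.
rewrite -exprVn lerXn2r ?nnegrE ?invr_ge0 ?(ltW e_gt0)//.
by rewrite (le_trans e_le)//; lra.
Qed.

Definition branch (b : nat -> nat) := forall m, b m = (b m.+1 %/ N)%N.

(** The limit of the nodes along an infinite branch, characterized by the rate of
    convergence. *)
Definition branch_end (b : nat -> nat) x :=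
  forall m, `|x - node m (b m)| <= 4 * L * clearance m.

(** The step after generation [k] is at most [L * clearance k] and [clearance]
    decreases at least as fast as the powers of [1 / 4], so that the steps after
    generation [m] add up to at most [2 * L * clearance m]; this bound passes to
    each coordinate of the limit. *)
Lemma branch_endP b : branch b -> exists x, branch_end b x.
Proof.
move=> bP; have L0 := L_gt0.
have step m n : `|node (m + n) (b (m + n)%N) - node m (b m)| <=
    2 * L * (clearance m - clearance (m + n)).
  elim: n => [|n IH]; first by rewrite addn0 !subrr normr0 mulr0.
  rewrite addnS (le_trans (ler_distD (node (m + n) (b (m + n)%N)) _ _))//.
  have := node_step (m + n) (b (m + n).+1); rewrite -bP => h.
  have : L * clearance (m + n).+1 <= L * (clearance (m + n) / 4).
    by rewrite ler_pM2l// clearanceS_le.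
  have : 0 < L * clearance (m + n) by rewrite mulr_gt0 ?clearance_gt0.
  lra.
have {}step m n : `|node (m + n) (b (m + n)%N) - node m (b m)| <= 2 * L * clearance m.
  rewrite (le_trans (step m n))// ler_pM2l ?mulr_gt0// gerBl.
  exact: ltW (clearance_gt0 _).
have [x xP] := @limit_with_errors R (fun m => re (node m (b m)))
  (fun m => 2 * L * clearance m) (fun m n =>
    le_trans (eq_ind _ (fun v => `|v| <= _) (re_le _) _ (reB _ _)) (step m n)).
have [y yP] := @limit_with_errors R (fun m => im (node m (b m)))
  (fun m => 2 * L * clearance m) (fun m n =>
    le_trans (eq_ind _ (fun v => `|v| <= _) (im_le _) _ (imB _ _)) (step m n)).
exists (pt x y) => m; rewrite (le_trans (norm_le_coord _))// reB imB.
by have := xP m; have := yP m; rewrite /re /im /=; lra.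
Qed.

(** The nodes of the branch are in the tree domain and their distance to the
    complement of [O] tends to 0. *)
Lemma branch_end_boundary b x : branch_end b x ->
  (boundary tree_domain `&` boundary O) x.
Proof.
move=> xP; have L0 := L_gt0.
have small (d : R) : 0 < d -> exists m, `|x - node m (b m)| < d /\ clearance m < d.
  move=> d0; have [|m md] := @clearance_small (d / (4 * L)).
    by rewrite divr_gt0 ?mulr_gt0.
  exists m; move: md; rewrite ltr_pdivlMr ?mulr_gt0// mulrC => md.
  split; first exact: le_lt_trans (xP m) md.
  rewrite (le_lt_trans _ md)// ler_peMl ?(ltW (clearance_gt0 m))//.
  by have := L_ge1; lra.
have Ox : ~ O x.
  move=> /(codist_gt0 O_co O_open) x0.
  have [|m [xm rm]] := small (codist O x / 2); first by rewrite divr_gt0.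
  have := codist_lip x (node m (b m)) O_co; rewrite node_codist; lra.
have cT : closure tree_domain x.
  move=> B /nbhs_ballP[d /= d0 dB].
  have [m [xm _]] := small d d0.
  exists (node m (b m)); split; first exact: node_tree.
  by apply: dB; rewrite -ball_normE.
split; split=> //; try by move=> /interior_subset; try move/tree_domain_sub.
by apply: closureS cT; exact: tree_domain_sub.
Qed.

(** At the first generation where the branches differ, the nodes are siblings at
    distance at least [9 * L * clearance j]; each end is within
    [4 * L * clearance j] of its node. *)
Lemma branch_end_sep b b' x x' m : branch b -> branch b' -> b 0%N = b' 0%N ->
  branch_end b x -> branch_end b' x' -> b m <> b' m -> L * clearance m <= `|x - x'|.
Proof.
move=> bP b'P b0 xP x'P; have L0 := L_gt0.
elim: m => [//|m IH] bm.
have [bm'|/eqP bm'] := eqVneq (b m) (b' m); last first.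
  rewrite (le_trans _ (IH bm'))// ler_pM2l//.
  by have := clearanceS_le m; have := clearance_gt0 m; lra.
have parent : (b m.+1 %/ N)%N = (b' m.+1 %/ N)%N by rewrite -bP -b'P.
have digit : (b m.+1 %% N)%N <> (b' m.+1 %% N)%N.
  by move=> h; apply: bm; rewrite (divn_eq (b m.+1) N) parent h -divn_eq.
have := child_sep (node_in m (b m.+1 %/ N)) (ltn_pmod (b m.+1) N_gt0)
  (ltn_pmod (b' m.+1) N_gt0) digit.
rewrite node_codist -clearanceS.
have -> : child (node m (b m.+1 %/ N)) (b m.+1 %% N) = node m.+1 (b m.+1) by [].
have -> : child (node m (b m.+1 %/ N)) (b' m.+1 %% N) = node m.+1 (b' m.+1).
  by rewrite parent.
have := xP m.+1; have := x'P m.+1.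
move: (node m.+1 _) (node m.+1 _) => p p' px px' pp'.
have h1 := ler_distD x p p'; have h2 := ler_distD x' x p'.
rewrite distrC in px'; lra.
Qed.

End john_tree.

(** * Content of the image of a digit-separating map *)

Section mass_distribution.
Context {R : realType} {V : normedModType R}.
Implicit Types (E A : set V) (f : R -> V).

Lemma diam_ge E p q : E p -> E q -> (`|p - q|%:E <= diam E)%E.
Proof.
move=> Ep Eq; rewrite le_max; apply/orP; right.
by apply: ereal_sup_ubound; exists (p, q).
Qed.

(** The first [m] digits of [t] in base [N], as the number that they spell. *)
Definition digits (N : nat) (t : R) (m : nat) : nat :=
  Num.truncn (t * N%:R ^+ m).

Lemma digits_itv N t m : (0 < N)%N -> 0 <= t ->
  (digits N t m)%:R / N%:R ^+ m <= t < (digits N t m).+1%:R / N%:R ^+ m.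
Proof.
move=> N0 t0; have Nm : 0 < N%:R ^+ m :> R by rewrite exprn_gt0// ltr0n.
rewrite ler_pdivrMr// ltr_pdivlMr//; apply: Num.Theory.truncn_itv.
by rewrite mulr_ge0// ltW.
Qed.

Lemma digits_branch N t : (0 < N)%N -> 0 <= t -> branch N (digits N t).
Proof.
move=> N0 t0 m; have N0' : 0 < N%:R :> R by rewrite ltr0n.
have y0 : 0 <= t * N%:R ^+ m by rewrite mulr_ge0// exprn_ge0// ltW.
rewrite /digits exprSr mulrA; set y := t * _ in y0 *.
have /andP[n1 n2] := Num.Theory.truncn_itv (mulr_ge0 y0 (ltW N0')).
set n := Num.truncn (y * N%:R) in n1 n2 *.
apply: Num.Theory.truncn_def; apply/andP; split.
  by rewrite -(ler_pM2r N0') (le_trans _ n1)// -natrM ler_nat leq_trunc_div.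
rewrite -(ltr_pM2r N0') (lt_le_trans n2)// -natrM ler_nat.
by rewrite ltn_ceil.
Qed.

Lemma digits0 N t : 0 <= t < 1 -> digits N t 0 = 0%N.
Proof.
by move=> t01; rewrite /digits expr0 mulr1; apply: Num.Theory.truncn_def.
Qed.

Context (f : R -> V) (N : nat) (e alpha rho : R).
Context (N_gt0 : (0 < N)%N) (e_gt0 : 0 < e) (e_lt1 : e < 1) (rho_gt0 : 0 < rho).
Context (alpha_gt0 : 0 < alpha) (N_e : (N%:R)^-1 <= e `^ alpha).
Context (f_digits : forall (s t : R) (m : nat), 0 <= s < 1 -> 0 <= t < 1 ->
  `|f s - f t| < rho * e ^+ m -> digits N s m = digits N t m).

Lemma exp_below (d : R) : 0 < d -> exists m, rho * e ^+ m <= d.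
Proof.
move=> d0.
have : (fun m => rho * e ^+ m) @ \oo --> (0 : R).
  rewrite -[X in _ --> X](mulr0 rho); apply: cvgMr; apply: cvg_expr.
  by rewrite ger0_norm// ltW.
move=> /cvgrPdist_le /(_ d d0) [m _ /(_ m (leqnn m))].
rewrite sub0r normrN ger0_norm ?mulr_ge0 ?exprn_ge0 ?(ltW rho_gt0) ?(ltW e_gt0)//.
by exists m.
Qed.

(** The parameters of the points of a set of diameter less than [rho * e ^ m]
    share their first [m] digits, hence lie in an interval of length [N ^ - m];
    the generation [m] is the last one that the diameter allows. *)
Lemma preimage_content E (eta : R) : 0 < eta -> exists I : set R,
  [/\ measurable I, (fun t => 0 <= t < 1 /\ E (f t)) `<=` I &
   (((rho * e) `^ alpha)%:E * lebesgue_measure I <= diam E `^ alpha + eta%:E)%E].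
Proof.
move=> eta0.
have l01 : lebesgue_measure (`[0, 1[ : set R) = 1%E.
  by rewrite lebesgue_measure_itv /= lte_fin ltr01 oppr0 adde0.
(* The slack makes the diameter positive, even for a single point. *)
have [d d0] : exists2 d : R, 0 < d &
    (d `^ alpha)%:E = (diam E `^ alpha + eta%:E)%E /\ (diam E < d%:E)%E
    \/ (diam E `^ alpha + eta%:E = +oo)%E.
  have : (0 <= diam E)%E by rewrite le_max lexx.
  case: (diam E) => [a||]; last 2 first.
  - by exists 1; rewrite // poweRyr ?gt_eqF//; right.
  - by rewrite leNgt ltNyr.
  - rewrite lee_fin => a0; pose b := a `^ alpha + eta.
    have b0 : 0 < b by rewrite ltr_wpDl// powR_ge0.
    exists (b `^ alpha^-1); first by rewrite powR_gt0.
    left; rewrite -powRrM mulVf ?gt_eqF// powRr1 ?(ltW b0)//; split=> //.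
    rewrite lte_fin -[ltLHS]powRr1// -(mulfV (lt0r_neq0 alpha_gt0)) powRrM.
    by rewrite gt0_ltr_powR ?invr_gt0// ?nnegrE ?powR_ge0 ?ltW// ltrDl.
move=> [[dE diamd]|->]; last first.
  exists `[0, 1[%classic; split; [exact: measurable_itv | | exact: leey].
  by move=> t [t01 _]; rewrite /= in_itv.
rewrite -dE; have [rd|dr] := leP rho d.
  exists `[0, 1[%classic; split; first exact: measurable_itv.
    by move=> t [t01 _]; rewrite /= in_itv.
  rewrite l01 mule1 lee_fin; apply: ge0_ler_powR; rewrite ?nnegrE ?(ltW alpha_gt0)//.
  - by rewrite mulr_ge0 ?ltW.
  - exact: ltW.
  - by rewrite (le_trans _ rd)// ler_piMr ?ltW.
have [m /andP[md dm]] : exists m, rho * e ^+ m.+1 <= d < rho * e ^+ m.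
  have ex : exists m, rho * e ^+ m <= d by exact: exp_below.
  case: (ex_minnP ex) => -[|m] md mmin.
    by move: md; rewrite expr0 mulr1 leNgt dr.
  by exists m; rewrite md ltNge; apply/negP => /mmin; rewrite ltnn.
have [[s [s01 Es]]|none] := pselect (exists s, 0 <= s < 1 /\ E (f s)); last first.
  exists set0; split=> //; first by move=> t Et; apply: none; exists t.
  by rewrite measure0 mule0 lee_fin powR_ge0.
have Nm : 0 < N%:R ^+ m :> R by rewrite exprn_gt0// ltr0n.
exists `[(digits N s m)%:R / N%:R ^+ m, (digits N s m).+1%:R / N%:R ^+ m[%classic.
split; first exact: measurable_itv.
  move=> t [t01 Et]; rewrite /= in_itv /=.
  rewrite (@f_digits s t m)//; first by apply: digits_itv => //; case/andP: t01.
  rewrite (lt_trans _ dm)// -lte_fin (le_lt_trans _ diamd)//.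
  exact: diam_ge.
rewrite lebesgue_measure_itv /= lte_fin ltr_pM2r ?invr_gt0// ltr_nat ltnSn.
rewrite -EFinB -mulrBl -[_.+1]addn1 natrD addrAC subrr add0r mul1r.
rewrite -EFinM lee_fin.
apply: (@le_trans _ _ ((rho * e ^+ m.+1) `^ alpha)); last first.
  apply: ge0_ler_powR; rewrite ?nnegrE ?(ltW alpha_gt0) ?(ltW d0)//.
  by rewrite mulr_ge0 ?exprn_ge0 ?(ltW rho_gt0) ?(ltW e_gt0).
rewrite exprS mulrA [leRHS]powRM ?mulr_ge0 ?exprn_ge0 ?(ltW rho_gt0) ?(ltW e_gt0)//.
apply: ler_wpM2l; first exact: powR_ge0.
rewrite -exprVn -powR_mulrn ?(ltW e_gt0)// -powRrM mulrC powRrM powR_mulrn ?powR_ge0//.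
by rewrite lerXn2r ?nnegrE ?invr_ge0 ?powR_ge0.
Qed.

(** The intervals that a cover of [A] gives by [preimage_content] cover [[0, 1[],
    whose Lebesgue measure is 1. *)
Lemma content_ge A : (forall t, 0 <= t < 1 -> A (f t)) ->
  (((rho * e) `^ alpha)%:E <= hausdorff_content alpha A)%E.
Proof.
move=> fA; apply/ereal_infP => _ [E AE <-].
apply/lee_addgt0Pr => eta eta0.
have eta' j : 0 < eta / (2 ^ j.+1)%:R by rewrite divr_gt0// ltr0n expn_gt0.
have [I IP] := choice (fun j => preimage_content (E j) (eta' j)).
apply: le_trans (epsilon_trick xpredT _ (ltW eta0)); last by move=> j; exact: poweR_ge0.
apply: (@le_trans _ _ (\sum_(0 <= j <oo)
    ((rho * e) `^ alpha)%:E * lebesgue_measure (I j))%E); last first.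
  apply: lee_nneseries => [j _ _|j _]; last by have [] := IP j.
  by rewrite mule_ge0// lee_fin powR_ge0.
rewrite nneseriesZl//.
rewrite -[leLHS]mule1; apply: lee_wpmul2l; first by rewrite lee_fin powR_ge0.
have <- : lebesgue_measure (`[0, 1[ : set R) = 1%E.
  by rewrite lebesgue_measure_itv /= lte_fin ltr01 oppr0 adde0.
apply: measure_sigma_subadditive; first by move=> j; have [] := IP j.
  exact: measurable_itv.
move=> t; rewrite /= in_itv /= => t01; have [j _ Ej] := AE _ (fA t t01).
by exists j => //; have [_ + _] := IP j; apply.
Qed.

End mass_distribution.

(** * The accessible part of the boundary *)

Section branching_number.
Context {R : realType}.

(** For [N = K ^ k] the inequality reads [alpha * (k + 1) <= k], which holds as
    soon as [k >= alpha / (1 - alpha)]. *)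
Lemma branching_number (alpha : R) (K : nat) : alpha < 1 -> (0 < K)%N ->
  exists2 N : nat, (0 < N)%N & (N%:R)^-1 <= ((K%:R * N%:R)^-1 : R) `^ alpha.
Proof.
move=> a1 K0; pose k := Num.truncn (alpha / (1 - alpha)); exists (K ^ k.+1)%N.
  by rewrite expn_gt0 K0.
have E (n : nat) : ((K ^ n)%:R : R)^-1 = K%:R `^ (- n%:R).
  by rewrite powRN powR_mulrn// natrX.
rewrite -natrM -expnS !E -powRrM; apply: ler_powR; first by rewrite ler1n.
have : alpha / (1 - alpha) < k.+1%:R by exact: Num.Theory.truncnS_gt.
rewrite ltr_pdivrMr ?subr_gt0// mulNr lerN2 [k.+2%:R]mulrSr; lra.
Qed.

End branching_number.

Theorem theorem1p1 (R : realType) (alpha : R)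
    (alpha_gt0 : 0 < alpha) (alpha_lt1 : alpha < 1) :
  exists C c : R, [/\ 0 < C, 0 < c &
    forall Omega : set (Rcomplex R),
      domain Omega -> bounded_set Omega -> simply_connected R Omega ->
      forall z : Rcomplex R, Omega z ->
      exists Omega_z : set (Rcomplex R),
        [/\ Omega_z `<=` Omega, john_domain C z Omega_z &
            (c%:E * dist_boundary Omega z `^ alpha
              <= hausdorff_content alpha
                   (boundary Omega_z `&` boundary Omega))%E]].
Proof.
(* [720 = 2 * 9 * 40]: the gap [r / (2 * N)] between the branches is then
   [9 * L * (e * r)], where [L = 40] bounds the length of the arcs. *)
have [N N0 Ne] := branching_number alpha_lt1 (isT : (0 < 720)%N).
have N0' : 0 < N%:R :> R by rewrite ltr0n.
set e : R := (720 * N%:R)^-1 in Ne *.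
have e0 : 0 < e by rewrite invr_gt0 mulr_gt0 ?ltr0n.
have e1 : e <= 1 / 4.
  rewrite /e div1r lef_pV2 ?posrE ?mulr_gt0 ?ltr0n//.
  have : 1 <= N%:R :> R by rewrite ler1n.
  lra.
pose L : R := 40.
exists (4 * L / e), ((L * e) `^ alpha); split.
- by rewrite divr_gt0 ?mulr_gt0.
- by rewrite powR_gt0 ?mulr_gt0.
move=> O [oO _ _] bO sc z Oz.
have O_co : ~` O !=set0.
  apply/set0P/eqP => OT.
  have [M [_ /(_ (M + 1))]] := bO; rewrite ltrDl => /(_ ltr01) MO.
  pose p := pt (`|M| + 2) 0 : Rcomplex R.
  have Op : O p by apply: contrapT => nOp; have : (~` O) p by []; rewrite OT.
  have := le_trans (re_le p) (MO p Op).
  have := ler_norm M; have := normr_ge0 M => ? ?.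
  rewrite {1}/re /= ger0_norm; lra.
have H w : exists c : nat -> Rcomplex R, O w ->
    (forall i, (i < N)%N -> codist O (c i) = e * codist O w /\
       linked O (e * codist O w) (L * codist O w) w (c i)) /\
    (forall i j, (i < N)%N -> (j < N)%N -> i <> j ->
       9 * L * (e * codist O w) <= `|c i - c j|).
  have [Ow|] := pselect (O w); last by exists (fun=> w).
  have [|c [c1 c2]] := @branching _ O w N e O_co sc (codist_gt0 O_co oO Ow) N0.
    by rewrite e0; lra.
  exists c => _; split=> // i j iN jN ij; rewrite (le_trans _ (c2 i j iN jN ij))//.
  rewrite le_eqVlt; apply/orP; left; apply/eqP; rewrite /e /L; field.
  by rewrite gt_eqF.
have [child childP] := choice H.
have childc w i Ow iN := ((childP w Ow).1 i iN).1.
have childl w i Ow iN := ((childP w Ow).1 i iN).2.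
have childs w i j Ow := (childP w Ow).2 i j.
have L1 : 1 <= L by rewrite /L; lra.
have r0 : 0 < codist O z by exact: codist_gt0.
exists (tree_domain O z N e L child); split.
- by apply: tree_domain_sub.
- by apply: tree_domain_john.
have E (t : R) : exists x, 0 <= t ->
    branch_end O z N e L child (digits N t) x.
  have [t0|t0] := leP 0 t; last by exists z.
  have [x xP] := branch_endP O_co oO Oz N0 e0 e1 L1 childc childl
    (digits_branch N0 t0).
  by exists x.
have [f fP] := choice E.
apply: (@le_trans _ _ ((L * codist O z * e) `^ alpha)%:E).
  rewrite mulrAC [(_ * codist O z) `^ _]powRM ?mulr_ge0 ?(ltW e0) ?(ltW r0)
    ?(le_trans ler01)//.
  rewrite EFinM; apply: lee_wpmul2l; first by rewrite lee_fin powR_ge0.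
  rewrite -poweR_EFin; apply: gt0_ler_poweR; rewrite ?(ltW alpha_gt0)//.
  - by rewrite in_itv /= leey andbT; exact: edist_inf_ge0.
  - by rewrite in_itv /= leey andbT lee_fin ltW.
  - exact: dist_boundary_le_codist.
apply: (@content_ge _ _ f N e alpha (L * codist O z)) => //.
- lra.
- by rewrite mulr_gt0// (lt_le_trans ltr01).
- move=> s t m s01 t01 st; have /andP[s0 _] := s01; have /andP[t0 _] := t01.
  apply: contrapT => nst.
  have b0 : digits N s 0 = digits N t 0 by rewrite !digits0.
  have := branch_end_sep O_co oO Oz N0 e0 e1 L1 childc childs
    (digits_branch N0 s0) (digits_branch N0 t0) b0 (fP s s0) (fP t t0) nst.
  by rewrite leNgt /clearance [e ^+ m * _]mulrC mulrA st.
- move=> t /andP[t0 _].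
  by apply: branch_end_boundary (fP t t0).
Qed.
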